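(* Let $1\le p<\infty$ and let $d_{w,p}$ be a Lorentz sequence space. The set $\mathcal{SS}_{d_{w,p}}$ of all $d_{w,p}$-strictly singular operators in $L(d_{w,p})$ is the greatest proper ideal in $L(d_{w,p})$: it is a proper two-sided ideal and contains every proper ideal of $L(d_{w,p})$. In particular, $\mathcal{SS}_{d_{w,p}}$ is norm closed.
   Context: Let $1\le p<\infty$ and let $w=(w_n)$ be a real sequence with $w_1=1$, $w_n\downarrow 0$ and $\sum_n w_n=\infty$. The Lorentz sequence space $d_{w,p}$ is the Banach space of all $x=(x_n)\in c_0$ with $\|x\|_{d_{w,p}}=\big(\sum_{n}w_n (x^*_n)^p\big)^{1/p}<\infty$, where $(x^*_n)$ is the non-increasing rearrangement of $(|x_n|)$. An operator $T\in L(d_{w,p})$ is $d_{w,p}$-strictly singular if for every closed subspace $Z\subseteq d_{w,p}$ isomorphic to $d_{w,p}$, the restriction $T|_Z$ is not an isomorphism. *)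

(* Defs.v *)
From HB Require Import structures.
From mathcomp Require Import all_boot all_order all_algebra.
From mathcomp Require Import all_classical all_reals all_analysis.
Set Implicit Arguments. Unset Strict Implicit. Unset Printing Implicit Defensive.
Import Order.TTheory GRing.Theory Num.Theory.
Import numFieldNormedType.Exports.
Local Open Scope classical_set_scope.
Local Open Scope ring_scope.

Section Lorentz.
Variable R : realType.

(* admissible lorentz_weight, 0-indexed: w 0 = w_1 = 1, w nonincreasing, w -> 0,
   sum w = +oo *)
Definition lorentz_weight (w : nat -> R) : Prop :=
  [/\ w 0%N = 1, (forall n, w n.+1 <= w n), w @ \oo --> (0:R)
    & (\sum_(0 <= n <oo) (w n)%:E = +oo)%E].

(* non-increasing rearrangement (0-indexed): x^*_n is the infimum over all sets
   of at most n indices of the supremum of |x_k| outside that set. *)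
Definition xstar (x : nat -> R) (n : nat) : R :=
  fine (ereal_inf [set ereal_sup [set (`|x k|)%:E | k in [set k | k \notin s]]
                  | s in [set s : seq nat | (size s <= n)%N]]).

Definition lsum (w : nat -> R) (p : R) (x : nat -> R) : \bar R :=
  (\sum_(0 <= n <oo) (w n * (xstar x n) `^ p)%:E)%E.

Definition in_d (w : nat -> R) (p : R) (x : nat -> R) : Prop :=
  x @ \oo --> (0:R) /\ (lsum w p x < +oo)%E.

Definition dnorm (w : nat -> R) (p : R) (x : nat -> R) : R :=
  (fine (lsum w p x)) `^ p^-1.

(* bounded linear operators on d_{w,p}; normalized to vanish off d_{w,p} so
   that operators are determined by their action on d_{w,p}. *)
Definition is_op (w : nat -> R) (p : R) (T : (nat -> R) -> (nat -> R)) : Prop :=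
  [/\ (forall x, in_d w p x -> in_d w p (T x)),
      (forall x, ~ in_d w p x -> T x = 0),
      (forall x y, in_d w p x -> in_d w p y -> T (x + y) = T x + T y),
      (forall (a : R) x, in_d w p x -> T (a *: x) = a *: T x)
    & exists C : R, forall x, in_d w p x -> dnorm w p (T x) <= C * dnorm w p x].

Definition Lop (w : nat -> R) (p : R) : set ((nat -> R) -> (nat -> R)) :=
  [set T | is_op w p T].

Definition closed_subspace (w : nat -> R) (p : R) (Z : set (nat -> R)) : Prop :=
  [/\ Z `<=` in_d w p, Z 0,
      (forall x y, Z x -> Z y -> Z (x + y)),
      (forall (a : R) x, Z x -> Z (a *: x))
    & forall (z : nat -> nat -> R) x, (forall n, Z (z n)) -> in_d w p x ->
        (fun n => dnorm w p (z n - x)) @ \oo --> (0:R) -> Z x].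

(* Z is isomorphic to d_{w,p}: there is a bounded linear map from d_{w,p} onto Z
   which is bounded below (hence a linear homeomorphism onto Z). *)
Definition iso_to_d (w : nat -> R) (p : R) (Z : set (nat -> R)) : Prop :=
  exists U, is_op w p U /\ (U @` in_d w p = Z) /\
    exists c : R, 0 < c /\ forall x, in_d w p x -> c * dnorm w p x <= dnorm w p (U x).

Definition iso_on (w : nat -> R) (p : R) (T : (nat -> R) -> (nat -> R))
  (Z : set (nat -> R)) : Prop :=
  exists c : R, 0 < c /\ forall z, Z z -> c * dnorm w p z <= dnorm w p (T z).

Definition d_strictly_singular (w : nat -> R) (p : R)
  (T : (nat -> R) -> (nat -> R)) : Prop :=
  is_op w p T /\
  forall Z, closed_subspace w p Z -> iso_to_d w p Z -> ~ iso_on w p T Z.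

Definition dwp_SS (w : nat -> R) (p : R) := [set T | d_strictly_singular w p T].

Definition dwp_ideal (w : nat -> R) (p : R) (J : set ((nat -> R) -> (nat -> R))) : Prop :=
  [/\ J `<=` Lop w p, J (fun _ => 0),
      (forall S T, J S -> J T -> J (S \+ T)),
      (forall (a : R) T, J T -> J (fun x => a *: T x))
    & (forall A T, is_op w p A -> J T -> J (A \o T) /\ J (T \o A))].

Definition dwp_proper_ideal (w : nat -> R) (p : R) J : Prop :=
  dwp_ideal w p J /\ J <> Lop w p.

Definition opnorm (w : nat -> R) (p : R) (T : (nat -> R) -> (nat -> R)) : \bar R :=
  ereal_sup [set (dnorm w p (T x))%:E | x in [set x | in_d w p x /\ dnorm w p x <= 1]].

Definition dwp_norm_closed (w : nat -> R) (p : R) (J : set ((nat -> R) -> (nat -> R))) : Prop :=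
  forall T, is_op w p T ->
    (forall e : R, 0 < e -> exists S, J S /\ (opnorm w p (fun x => T x - S x)%R < e%:E)%E) -> J T.

End Lorentz.

(* Main.v *)
Require Import Defs.
From HB Require Import structures.
From mathcomp Require Import all_boot all_order all_algebra.
From mathcomp Require Import all_classical all_reals all_analysis.
From mathcomp Require Import lra zify.
Import Order.TTheory GRing.Theory Num.Theory.
Import numFieldNormedType.Exports.
Local Open Scope classical_set_scope.
Local Open Scope ring_scope.

Set Implicit Arguments. Unset Strict Implicit. Unset Printing Implicit Defensive.

(* The class of strictly singular operators is identified with the operators [T]
   such that, for every operator [U], [T (U e_n)] tends to 0 in sup norm; this
   description is visibly stable under sums, limits and composition on the right.
   It rests on two facts about an operator [V].
   (1) If [V e_n] tends to 0 in sup norm, then [V] is not bounded below: most of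
   the norm of [V e_n] is carried far out in the weight, so by averaging over
   signs some sum of [K] vectors [+-V e_n] has [p]-th power of its norm at least
   of order [K], while the corresponding sum of basis vectors only has
   [w_1 + ... + w_K = o(K)].
   (2) Otherwise the identity factors through [V]: compress [V] to subsequences
   of rows and columns along which its matrix is, up to a diagonal factor, a
   small perturbation of the identity, hence invertible.
   By (2), an ideal with an operator that is not strictly singular contains the
   identity. *)

Section LorentzIdeals.
Variables (R : realType) (w : nat -> R) (p : R).
Hypotheses (p_ge1 : 1 <= p) (w_lorentz : lorentz_weight w).

Implicit Types (x y z : nat -> R) (s t : seq nat).

Let p_gt0 : 0 < p. Proof. exact: lt_le_trans p_ge1. Qed.
Let p_ge0 : 0 <= p. Proof. exact: ltW. Qed.
Let p_neq0 : p != 0. Proof. exact: lt0r_neq0. Qed.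

(** * Powers and the weight *)

Lemma cvg0P x : x @ \oo --> (0 : R) <->
  forall e, 0 < e -> exists N, forall n, (N <= n)%N -> `|x n| <= e.
Proof.
split=> [/cvgr0Pnorm_le h e /h [N _ hN]|h]; first by exists N => n /hN.
apply/cvgr0Pnorm_le => e /h [N hN]; exists N => // n /=; exact: hN.
Qed.

Lemma powR_leP a b : 0 <= a -> 0 <= b -> (a `^ p <= b `^ p) = (a <= b).
Proof.
move=> a0 b0; apply/idP/idP => [|ab]; last by rewrite ge0_ler_powR.
by apply: contraTT; rewrite -!ltNge => ba; rewrite gt0_ltr_powR.
Qed.

Lemma powR_div (a b : R) : 0 <= a -> 0 < b -> (a / b) `^ p = a `^ p / b `^ p.
Proof.
move=> a0 b0; apply/(mulIf (lt0r_neq0 (powR_gt0 p b0))).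
by rewrite -powRM ?divr_ge0 ?(ltW b0) // !divfK // lt0r_neq0 ?powR_gt0.
Qed.

Lemma powR_convex (l a b : R) : 0 <= l <= 1 -> 0 <= a -> 0 <= b ->
  (l * a + (1 - l) * b) `^ p <= l * a `^ p + (1 - l) * b `^ p.
Proof.
move=> /andP[l0 l1] a0 b0.
have := @convex_powR R p p_ge1 (Itv01 l0 l1) a b.
rewrite !convRE /= !inE /= !in_itv /= !andbT => h; exact: h.
Qed.

(** Convexity of the [p]-th power, [a] being the midpoint of [a + b] and [a - b]. This is the source
    of the averaging over signs. *)
Lemma powR_norm_midpoint (a b : R) :
  `|a| `^ p <= 2^-1 * `|a + b| `^ p + 2^-1 * `|a - b| `^ p.
Proof.
have hh : 0 <= (2^-1 : R) <= 1 by apply/andP; split; lra.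
have := powR_convex hh (normr_ge0 (a + b)) (normr_ge0 (a - b)).
have -> : 1 - 2^-1 = 2^-1 :> R by lra.
apply: le_trans; rewrite powR_leP ?normr_ge0 ?addr_ge0 ?mulr_ge0 ?invr_ge0 //.
have := ler_normD (a + b) (a - b).
have -> : a + b + (a - b) = 2 * a by lra.
rewrite normrM ger0_norm //; lra.
Qed.

Lemma w_anti m n : (m <= n)%N -> w n <= w m.
Proof.
case: w_lorentz => _ hw _ _; elim: n => [|n IH].
  by rewrite leqn0 => /eqP->.
rewrite leq_eqVlt => /orP[/eqP->//|]; rewrite ltnS => /IH; exact: le_trans.
Qed.

Lemma w_ge0 n : 0 <= w n.
Proof.
case: w_lorentz => _ _ /cvg0P hw _; rewrite leNgt; apply/negP => wn.
have [N hN] := hw (- (w n / 2)) ltac:(lra).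
have := hN _ (leq_maxl N n); have := w_anti (leq_maxr N n) => h1.
rewrite ler0_norm; lra.
Qed.

Lemma w_le1 n : w n <= 1.
Proof. by case: w_lorentz => <- *; apply: w_anti. Qed.

Definition wcum N := \sum_(0 <= j < N) w j.

Lemma wcum_unbounded (B : R) : exists N, B < wcum N.
Proof.
case: w_lorentz => _ _ _ hw; apply: contrapT => /forallNP h.
have : (\sum_(0 <= n <oo) (w n)%:E <= B%:E)%E.
  apply: lime_le; first by apply: is_cvg_nneseries => n _ _; rewrite lee_fin w_ge0.
  near=> n; rewrite sumEFin lee_fin leNgt; apply/negP; exact: h.
by rewrite hw leye_eq.
Unshelve. all: by end_near. Qed.

(** The Cesaro means of [w] tend to 0 with [w]. One such [N] is enough to contradict a lower bound
    that is linear in [N]. *)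
Lemma wcum_small e : 0 < e -> exists2 N, (0 < N)%N & wcum N <= e * N%:R.
Proof.
case: w_lorentz => _ _ /cesaro /cvg0P hw _ /hw [N hN].
exists N.+1 => //; have := hN N (leqnn N).
rewrite /arithmetic_mean /= /series /= => h.
have := le_trans (ler_norm _) h.
by rewrite ler_pdivrMl ?ltr0n // mulrC.
Qed.

Lemma wcum_ge1 N : (0 < N)%N -> 1 <= wcum N.
Proof.
case: N => // N _; rewrite /wcum big_nat_recl //.
by case: w_lorentz => -> _ _ _; rewrite lerDl sumr_ge0 // => *; exact: w_ge0.
Qed.

(** * Weighted sums along finite lists of indices *)

(** A substitute for the rearrangement: for [x] in the space, the supremum of [wsum 0 x s] over
    duplicate-free [s], in any order, is the [p]-th power of the norm. The offset [a] lets sums over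
    concatenated lists split. *)
Fixpoint wsum a x s : R :=
  if s is i :: s' then w a * `|x i| `^ p + wsum a.+1 x s' else 0.

Lemma wsum_cat a x s t : wsum a x (s ++ t) = wsum a x s + wsum (a + size s) x t.
Proof.
by elim: s a => [|i s IH] a /=; rewrite ?add0r ?addn0 // IH addrA addSnnS.
Qed.

Lemma le_wsum a x y s : (forall i, i \in s -> `|x i| <= `|y i|) ->
  wsum a x s <= wsum a y s.
Proof.
elim: s a => //= i s IH a h; rewrite lerD ?IH //.
  by rewrite ler_wpM2l ?w_ge0 // powR_leP // h // inE eqxx.
by move=> j js; rewrite h // inE js orbT.
Qed.

Lemma wsum_shift a b x s : (a <= b)%N -> wsum b x s <= wsum a x s.
Proof.
elim: s a b => //= i s IH a b ab; rewrite lerD ?IH //.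
by rewrite ler_wpM2r ?powR_ge0 ?w_anti.
Qed.

(** Removing an index moves the later ones to weights that are no smaller, so only the removed terms
    are lost, each at most [b ^ p] because weights are at most 1. *)
Lemma wsum_filter a x s (P : pred nat) (b : R) :
  (forall i, i \in s -> ~~ P i -> `|x i| <= b) ->
  wsum a x s <= wsum a x (seq.filter P s) + (count (predC P) s)%:R * b `^ p.
Proof.
elim: s a => /= [|i s IH] a h; first by rewrite mul0r addr0.
have /IH{}IH : forall j, j \in s -> ~~ P j -> `|x j| <= b.
  by move=> j js; apply: h; rewrite inE js orbT.
case: ifPn => Pi /=; first by rewrite add0n -addrA lerD2l.
have xi : `|x i| <= b by rewrite h ?inE ?eqxx.
rewrite natrD mulrDl mul1r addrCA lerD //; last first.
  by rewrite (le_trans (IH _)) // lerD2r wsum_shift.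
rewrite -[leRHS]mul1r ler_pM ?w_ge0 ?powR_ge0 ?w_le1 //.
by rewrite powR_leP // (le_trans _ xi).
Qed.

Lemma wsum_le_wcum x s (b : R) : (forall i, i \in s -> `|x i| <= b) ->
  wsum 0 x s <= wcum (size s) * b `^ p.
Proof.
elim/last_ind: s => [|s i IH] h; first by rewrite /wcum big_geq // mul0r.
have /IH{}IH : forall j, j \in s -> `|x j| <= b.
  by move=> j js; rewrite h // mem_rcons inE js orbT.
rewrite -cats1 wsum_cat size_cat /= addn1 /wcum big_nat_recr //= mulrDl lerD //.
have xi : `|x i| <= b by rewrite h // mem_rcons inE eqxx.
by rewrite addr0 ler_wpM2l ?w_ge0 // powR_leP // (le_trans _ xi).
Qed.

Lemma wsum_le_size a x s (b : R) : (forall i, i \in s -> `|x i| <= b) ->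
  wsum a x s <= (size s)%:R * b `^ p.
Proof.
move=> h; have := @wsum_filter a x s pred0 b.
rewrite filter_pred0 add0r (_ : count _ s = size s); first by apply=> *; apply: h.
by rewrite -[RHS](count_predT s); apply: eq_count.
Qed.

Lemma wsum_midpoint a x y s :
  wsum a x s <= 2^-1 * wsum a (x + y) s + 2^-1 * wsum a (x - y) s.
Proof.
elim: s a => [|i s IH] a /=; first by rewrite !mulr0 addr0.
have := IH a.+1; have := powR_norm_midpoint (x i) (y i).
move=> /(ler_wpM2l (w_ge0 a)).
rewrite (_ : (x + y) i = x i + y i) // (_ : (x - y) i = x i - y i) //.
lra.
Qed.

Lemma wsumZ a (c : R) x s : wsum a (c *: x) s = `|c| `^ p * wsum a x s.
Proof.
elim: s a => [|i s IH] a /=; first by rewrite mulr0.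
by rewrite IH mulrDr normrM powRM // mulrCA.
Qed.

(** Minkowski's inequality: [x + y] is [A + B] times the convex combination of [x / A] and [y / B]
    with coefficients [l = A / (A + B)] and [1 - l], and convexity applies entry by entry. *)
Lemma wsumD a x y s (A B : R) : 0 < A -> 0 < B ->
  wsum a x s <= A `^ p -> wsum a y s <= B `^ p ->
  wsum a (x + y) s <= (A + B) `^ p.
Proof.
move=> A0 B0 hx hy.
pose l := A / (A + B).
have l01 : 0 <= l <= 1.
  by rewrite /l divr_ge0 ?ler_pdivrMr /= ?mul1r; lra.
have lA : (A + B) * l = A by rewrite /l mulrC divfK // lt0r_neq0 ?addr_gt0.
have lB : (A + B) * (1 - l) = B by rewrite mulrBr lA; lra.
clearbody l.
have key : wsum a (x + y) s <= (A + B) `^ p *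
    (l * (wsum a x s / A `^ p) + (1 - l) * (wsum a y s / B `^ p)).
  elim: s a {hx hy} => [|i s IH] a /=; first by rewrite !mul0r !mulr0 addr0 mulr0.
  have := IH a.+1.
  set X := wsum _ x _; set Y := wsum _ y _; set Z := wsum _ _ _.
  have : `|(x + y) i| `^ p <= (A + B) `^ p *
      (l * (`|x i| `^ p / A `^ p) + (1 - l) * (`|y i| `^ p / B `^ p)).
    have := powR_convex l01 (divr_ge0 (normr_ge0 (x i)) (ltW A0))
      (divr_ge0 (normr_ge0 (y i)) (ltW B0)).
    rewrite !powR_div //; move=> /(ler_wpM2l (powR_ge0 (A + B) p)); apply: le_trans.
    have AB : (A + B) * (l * (`|x i| / A) + (1 - l) * (`|y i| / B)) = `|x i| + `|y i|.
      rewrite mulrDr !mulrA lA lB ![_ * `|_|]mulrC -!mulrA !mulfV ?lt0r_neq0 //.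
      by rewrite !mulr1.
    have AB0 : 0 <= A + B by lra.
    have AB1 : 0 <= l * (`|x i| / A) + (1 - l) * (`|y i| / B).
      by rewrite addr_ge0 // mulr_ge0 ?divr_ge0 //; lra.
    rewrite -powRM // AB powR_leP ?addr_ge0 //; exact: ler_normD.
  move=> /(ler_wpM2l (w_ge0 a)).
  lra.
apply: (le_trans key); rewrite -[leRHS]mulr1 ler_wpM2l ?powR_ge0 //.
have hx' : wsum a x s / A `^ p <= 1 by rewrite ler_pdivrMr ?powR_gt0 ?mul1r.
have hy' : wsum a y s / B `^ p <= 1 by rewrite ler_pdivrMr ?powR_gt0 ?mul1r.
case/andP: l01 => l0 l1; have l1' : 0 <= 1 - l by lra.
by have := ler_wpM2l l0 hx'; have := ler_wpM2l l1' hy'; lra.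
Qed.

(** * Non-increasing rearrangement against weighted sums *)

Lemma cvg0_bounded x : x @ \oo --> (0 : R) -> exists B, forall n, `|x n| <= B.
Proof.
move=> /cvg0P /(_ 1 ltr01) [N hN].
exists (1 + \sum_(0 <= j < N) `|x j|) => n; case: (leqP N n) => nN.
  by rewrite (le_trans (hN _ nN)) // lerDl sumr_ge0.
rewrite (bigD1_seq n) ?mem_index_iota ?iota_uniq //= addrCA lerDl addr_ge0 //.
by rewrite sumr_ge0.
Qed.

Lemma fresh_index s N : exists2 k, k \notin s & (N <= k)%N.
Proof.
(* The successor of the sum of a list exceeds all its entries; later proofs use it again as a bound
   for the indices in a list. *)
exists (N + (\sum_(j <- s) j).+1)%N; last exact: leq_addr.
apply/negP => ks; set k := (_ + _)%N in ks.
have : (k <= \sum_(j <- s) j)%N by rewrite (big_rem k) //= leq_addr.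
by rewrite /k; lia.
Qed.

Definition sup_off x s : \bar R :=
  ereal_sup [set (`|x k|)%:E | k in [set k | k \notin s]].

Lemma sup_off_ge x s k : k \notin s -> (`|x k|%:E <= sup_off x s)%E.
Proof. by move=> ks; apply: ereal_sup_ubound; exists k. Qed.

Lemma xstar_inf_ge0 x n :
  (0 <= ereal_inf [set sup_off x s | s in [set s | (size s <= n)%N]])%E.
Proof.
apply: le_ereal_inf_tmp => _ [s _ <-]; have [k ks _] := fresh_index s 0.
exact: le_trans (sup_off_ge x ks).
Qed.

Lemma xstar_le x n s B : (size s <= n)%N -> (forall k, k \notin s -> `|x k| <= B) ->
  xstar x n <= B.
Proof.
move=> sn h; rewrite -[leRHS]/(fine B%:E) fine_le //; last first.
- apply: (@le_trans _ _ (sup_off x s)); first by apply: ereal_inf_lbound; exists s.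
  by apply: ge_ereal_sup => _ [k ks <-]; rewrite lee_fin h.
- rewrite ge0_fin_numE ?xstar_inf_ge0 //.
  apply: (@le_lt_trans _ _ (sup_off x s)); first by apply: ereal_inf_lbound; exists s.
  apply: (@le_lt_trans _ _ B%:E); last exact: ltry.
  by apply: ge_ereal_sup => _ [k ks <-]; rewrite lee_fin h.
Qed.

(** Convergence to 0 bounds [x], so the infimum is finite and [fine] does not fall back on its
    default value. *)
Lemma xstar_ge x n c : x @ \oo --> (0 : R) ->
  (forall s, (size s <= n)%N -> exists2 k, k \notin s & c <= `|x k|) ->
  c <= xstar x n.
Proof.
move=> /cvg0_bounded [B hB] h; rewrite -[leLHS]/(fine c%:E) fine_le //; last first.
- apply: le_ereal_inf_tmp => _ [s /h [k ks ck] <-].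
  by rewrite (le_trans _ (sup_off_ge x ks)) // lee_fin.
- rewrite ge0_fin_numE ?xstar_inf_ge0 //.
  apply: (@le_lt_trans _ _ (sup_off x [::])).
    by apply: ereal_inf_lbound; exists [::].
  apply: (@le_lt_trans _ _ B%:E); last exact: ltry.
  by apply: ge_ereal_sup => _ [k ks <-]; rewrite lee_fin hB.
Qed.

Lemma xstar_ge0 x n : 0 <= xstar x n.
Proof. by rewrite fine_ge0 // xstar_inf_ge0. Qed.

Lemma seq_min (f : nat -> R) s : s != [::] ->
  exists2 m, m \in s & forall i, i \in s -> f m <= f i.
Proof.
elim: s => // i s IH _; case: (eqVneq s [::]) => [->|/IH [m ms hm]].
  by exists i => [|j]; rewrite inE // => /eqP->.
have [le_im|/ltW le_mi] := leP (f i) (f m).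
  exists i; first by rewrite inE eqxx.
  by move=> j; rewrite inE => /orP[/eqP-> //|/hm]; exact: le_trans.
exists m; first by rewrite inE ms orbT.
by move=> j; rewrite inE => /orP[/eqP-> //|/hm].
Qed.

Lemma wsum_min_last a x m s : (forall i, i \in s -> `|x m| <= `|x i|) ->
  wsum a x (m :: s) <= wsum a x (rcons s m).
Proof.
elim: s a => //= i s IH a h.
have /(IH a.+1) {}IH : forall j, j \in s -> `|x m| <= `|x j|.
  by move=> j js; rewrite h // inE js orbT.
apply: le_trans (_ : w a * `|x i| `^ p + wsum a.+1 x (m :: s) <= _); last first.
  by rewrite lerD2l.
have hmi : `|x m| `^ p <= `|x i| `^ p by rewrite powR_leP // h // inE eqxx.
have := w_anti (leqnSn a) => hw /=; nra.
Qed.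

(** Induction, moving a smallest entry to the end, which does not decrease the sum. That entry is at
    most the last rearranged value, since a list shorter than [s] misses an index of [s]. *)
Lemma wsum_le_xstar a x s : x @ \oo --> (0 : R) -> uniq s ->
  wsum a x s <= \sum_(0 <= j < size s) w (a + j) * xstar x j `^ p.
Proof.
move=> x0; have [n] := ubnP (size s); elim: n s => // n IH s sn us.
case: (eqVneq s [::]) => [->|/(seq_min (fun j => `|x j|))[m ms hm]].
  by rewrite big_geq.
have uz : size s = (size (rem m s)).+1.
  by rewrite size_rem // prednK //; case: (s) ms.
apply: (@le_trans _ _ (wsum a x (rcons (rem m s) m))).
  have [s1 [s2 [hs hr]]] : exists s1 s2, s = s1 ++ m :: s2 /\ rem m s = s1 ++ s2.
    case/splitPr: (ms) us => s1 s2 us; exists s1, s2; split => //.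
    rewrite remE index_cat /=; move: us.
    rewrite cat_uniq /= => /and3P[_ /norP[/negPf-> _] _].
    rewrite eqxx addn0 take_size_cat // drop_cat ltnNge leqnSn /=.
    by rewrite subSn // subnn /= drop0.
  rewrite hr {1}hs rcons_cat !wsum_cat lerD2l wsum_min_last // => i i2.
  by rewrite hm // hs mem_cat inE i2 !orbT.
rewrite -cats1 wsum_cat uz big_nat_recr //= addr0 lerD //.
  by apply: IH; [rewrite -ltnS -uz|exact: rem_uniq].
rewrite ler_wpM2l ?w_ge0 // powR_leP ?xstar_ge0 //.
apply: xstar_ge => // t ht.
have [k ks kt] : exists2 k, k \in s & k \notin t.
  apply/allPn; apply/negP => /allP sub.
  by have := uniq_leq_size us sub; rewrite uz => /leq_trans/(_ ht); rewrite ltnn.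
by exists k => //; exact: hm.
Qed.

(** If some entry off [s] is nonzero, all but finitely many entries are no larger, so the maximum is
    one over a finite list. *)
Lemma max_off x s : x @ \oo --> (0 : R) ->
  exists2 k, k \notin s & forall j, j \notin s -> `|x j| <= `|x k|.
Proof.
move=> x0; have [k0 k0s _] := fresh_index s 0.
have [[k ks xk]|h] := pselect (exists2 k, k \notin s & 0 < `|x k|); last first.
  exists k0 => // j js; apply: le_trans (normr_ge0 _).
  by rewrite leNgt; apply/negP => xj; apply: h; exists j.
have [N hN] := (iffLR (cvg0P x)) x0 _ xk.
pose t := [seq j <- k :: iota 0 N | j \notin s].
have kt : k \in t by rewrite mem_filter ks inE eqxx.
have [|m mt hm] := @seq_min (fun j => - `|x j|) t; first by case: (t) kt.
exists m; first by move: mt; rewrite mem_filter => /andP[].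
move=> j js; rewrite -lerN2; have [Nj|jN] := leqP N j.
  by rewrite (le_trans (hm _ kt)) // lerN2 hN.
by apply: hm; rewrite mem_filter js inE mem_iota /= add0n jN orbT.
Qed.

(** Greedy choice: a largest entry off the indices already taken bounds the next rearranged
    value. *)
Lemma exists_wsum_ge_xstar x N : x @ \oo --> (0 : R) -> exists s,
  [/\ uniq s, size s = N &
    \sum_(0 <= j < N) w j * xstar x j `^ p <= wsum 0 x s].
Proof.
move=> x0; elim: N => [|N [s [us sN hs]]]; first by exists [::]; rewrite big_geq.
have [k ks hk] := max_off s x0; exists (rcons s k).
rewrite rcons_uniq ks us size_rcons sN; split => //.
rewrite big_nat_recr //= -cats1 wsum_cat lerD //= addr0 sN.
rewrite ler_wpM2l ?w_ge0 // powR_leP ?xstar_ge0 //.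
by apply: (@xstar_le _ _ s); rewrite ?sN.
Qed.

(** * The norm in terms of weighted sums *)

Let term_ge0 x n : (0 <= (w n * xstar x n `^ p)%:E)%E.
Proof. by rewrite lee_fin mulr_ge0 ?w_ge0 ?powR_ge0. Qed.

Lemma lsum_ge0 x : (0 <= lsum w p x)%E.
Proof. by apply: nneseries_ge0 => n _ _; exact: term_ge0. Qed.

Lemma lsum_le x (M : R) : x @ \oo --> (0 : R) ->
  (forall s, uniq s -> wsum 0 x s <= M) -> (lsum w p x <= M%:E)%E.
Proof.
move=> x0 h; apply: lime_le; first by apply: is_cvg_nneseries.
near=> n; rewrite sumEFin lee_fin.
by have [s [us _ /le_trans->//]] := exists_wsum_ge_xstar n x0; exact: h.
Unshelve. all: by end_near. Qed.

Lemma wsum_le_lsum x s : x @ \oo --> (0 : R) -> uniq s ->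
  ((wsum 0 x s)%:E <= lsum w p x)%E.
Proof.
move=> x0 us.
apply: (@le_trans _ _ (\sum_(0 <= j < size s) (w j * xstar x j `^ p)%:E)%E).
  by rewrite sumEFin lee_fin; exact: wsum_le_xstar.
exact: nneseries_lim_ge.
Qed.

(** If infinitely many entries had size at least [e], any [N] of them would give a sum of at least
    [wcum N * e ^ p], which is unbounded because the weight is not summable. *)
Lemma wsum_bounded_cvg0 x (M : R) :
  (forall s, uniq s -> wsum 0 x s <= M) -> x @ \oo --> (0 : R).
Proof.
move=> hM; apply/cvg0P => e e0; apply: contrapT => /forallNP h.
have {}h N : exists2 n, (N <= n)%N & e <= `|x n|.
  have /existsNP[n /not_implyP[Nn /negP]] := h N.
  by rewrite -ltNge => /ltW; exists n.
have [N] := wcum_unbounded (M / e `^ p).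
rewrite ltr_pdivrMr ?powR_gt0 //; apply/negP; rewrite -leNgt.
suff [s [us _ hs]] : exists s, [/\ uniq s, size s = N & wcum N * e `^ p <= wsum 0 x s].
  exact: le_trans (hM s us).
elim: N => [|N [s [us sN hs]]]; first by exists [::]; rewrite /wcum big_geq // mul0r.
have [k /= hk ek] := h (\sum_(j <- s) j).+1.
have ks : k \notin s.
  by apply/negP => ks; move: hk; rewrite (big_rem k) //= ltnNge leq_addr.
exists (rcons s k); rewrite rcons_uniq ks us size_rcons sN; split => //.
rewrite /wcum big_nat_recr //= -cats1 wsum_cat mulrDl lerD //= addr0 sN.
by rewrite ler_wpM2l ?w_ge0 // powR_leP ?(ltW e0).
Qed.

Lemma dnorm_ge0 x : 0 <= dnorm w p x.
Proof. exact: powR_ge0. Qed.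

Lemma wsum_le_dnorm x s : in_d w p x -> uniq s -> wsum 0 x s <= dnorm w p x `^ p.
Proof.
move=> [x0 xfin] us; rewrite /dnorm -powRrM mulVf // powRr1 ?fine_ge0 ?lsum_ge0 //.
rewrite -[leLHS]/(fine (wsum 0 x s)%:E) fine_le ?wsum_le_lsum //.
by rewrite ge0_fin_numE ?lsum_ge0.
Qed.

(** Together with [wsum_le_dnorm] this describes space and norm by weighted sums alone; the
    rearrangement does not occur afterwards. *)
Lemma in_d_dnorm_le x B : 0 <= B -> (forall s, uniq s -> wsum 0 x s <= B `^ p) ->
  in_d w p x /\ dnorm w p x <= B.
Proof.
move=> B0 h; have x0 := wsum_bounded_cvg0 h; have hl := lsum_le x0 h.
have fin : (lsum w p x < +oo)%E by exact: le_lt_trans hl (ltry _).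
split=> //; rewrite -powR_leP ?dnorm_ge0 //.
rewrite /dnorm -powRrM mulVf // powRr1 ?fine_ge0 ?lsum_ge0 //.
by rewrite -[leRHS]/(fine (B `^ p)%:E) fine_le // ge0_fin_numE ?lsum_ge0.
Qed.

Local Opaque dnorm.

Lemma in_d_le x y : in_d w p y -> (forall i, `|x i| <= `|y i|) ->
  in_d w p x /\ dnorm w p x <= dnorm w p y.
Proof.
move=> dy h; apply: in_d_dnorm_le; first exact: dnorm_ge0.
by move=> s us; apply: le_trans (wsum_le_dnorm dy us); exact: le_wsum.
Qed.

Lemma in_d_comp x (f : nat -> nat) : injective f -> in_d w p x ->
  in_d w p (x \o f) /\ dnorm w p (x \o f) <= dnorm w p x.
Proof.
move=> fi dx; apply: in_d_dnorm_le; first exact: dnorm_ge0.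
move=> s us; apply: le_trans (wsum_le_dnorm dx (_ : uniq (map f s))).
  by elim: s 0%N {us} => //= i s IH a; rewrite lerD2l.
by rewrite map_inj_uniq.
Qed.

Lemma in_dD x y : in_d w p x -> in_d w p y ->
  in_d w p (x + y) /\ dnorm w p (x + y) <= dnorm w p x + dnorm w p y.
Proof.
move=> dx dy.
(* The slack [e] makes both radii positive, as [wsumD] divides by them. *)
have key e : 0 < e -> in_d w p (x + y) /\
    dnorm w p (x + y) <= (dnorm w p x + e) + (dnorm w p y + e).
  have := wsum_le_dnorm dx; have := wsum_le_dnorm dy.
  have := dnorm_ge0 x; have := dnorm_ge0 y.
  move: (dnorm w p x) (dnorm w p y) => a b b0 a0 hb ha e0.
  apply: in_d_dnorm_le => [|s us]; first lra.
  apply: wsumD; [lra|lra|..].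
    by apply: (le_trans (ha s us)); rewrite powR_leP; lra.
  by apply: (le_trans (hb s us)); rewrite powR_leP; lra.
split; first by have [] := key 1 ltr01.
apply/ler_addgt0Pr => e e0; have [] := key (e / 2) ltac:(lra) => _.
move: (dnorm w p x) (dnorm w p y) (dnorm w p (x + y)) => a b c; lra.
Qed.

Lemma in_dZ (c : R) x : in_d w p x ->
  in_d w p (c *: x) /\ dnorm w p (c *: x) <= `|c| * dnorm w p x.
Proof.
move=> dx; apply: in_d_dnorm_le; first by rewrite mulr_ge0 ?dnorm_ge0.
move=> s us; rewrite wsumZ powRM ?dnorm_ge0 // ler_wpM2l ?powR_ge0 //.
exact: wsum_le_dnorm.
Qed.

Lemma in_d0 : in_d w p 0 /\ dnorm w p 0 = 0.
Proof.
have [|s us|d0 h] := @in_d_dnorm_le 0 0 => //.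
  rewrite powR0 //; elim: s 0%N us => //= i s IH a /andP[_ /(IH a.+1) h].
  by rewrite normr0 powR0 // mulr0 add0r.
by split=> //; apply/eqP; rewrite eq_le h dnorm_ge0.
Qed.

Lemma in_dB x y : in_d w p x -> in_d w p y ->
  in_d w p (x - y) /\ dnorm w p (x - y) <= dnorm w p x + dnorm w p y.
Proof.
move=> dx dy; have [dNy Ny] := in_dZ (-1) dy.
have e : (-1 : R) *: y = - y by apply/funext => i; exact: mulN1r.
move: dNy Ny; rewrite e normrN normr1 mul1r => dNy Ny.
have [d h] := in_dD dx dNy; split; first exact: d.
by apply: (le_trans h); rewrite lerD2l.
Qed.

Lemma norm_le_dnorm x i : in_d w p x -> `|x i| <= dnorm w p x.
Proof.
move=> dx; rewrite -powR_leP ?dnorm_ge0 //.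
have := wsum_le_dnorm dx (isT : uniq [:: i]) => /=.
by case: w_lorentz => -> _ _ _; rewrite mul1r addr0.
Qed.

Lemma wcum_le m n : (m <= n)%N -> wcum m <= wcum n.
Proof.
move=> /subnKC <-; elim: (n - m)%N => [|k IH]; first by rewrite addn0.
by rewrite addnS /wcum big_nat_recr //= (le_trans IH) // lerDl w_ge0.
Qed.

Lemma wcum_ge0 N : 0 <= wcum N.
Proof. by apply: sumr_ge0 => *; exact: w_ge0. Qed.

(** * Flat vectors and signs *)

(** Meant for sums of [N] basis vectors with signs; the norm bound only uses the size of the support
    and of the entries. *)
Definition flat N x := exists s,
  [/\ (size s <= N)%N, forall k, k \notin s -> x k = 0 & forall k, `|x k| <= 1].

Definition unit_vec (n : nat) : nat -> R := fun k => (k == n)%:R.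

Lemma flat_in_d N x : flat N x ->
  in_d w p x /\ dnorm w p x <= wcum N `^ p^-1.
Proof.
move=> [s [sN xs x1]]; apply: in_d_dnorm_le; first exact: powR_ge0.
move=> t ut; rewrite -powRrM mulVf // powRr1 ?wcum_ge0 //.
have := @wsum_filter 0 x t (mem s) 0.
rewrite powR0 // mulr0 addr0 => /(_ _)/le_trans -> //.
  by move=> i _ /= /xs ->; rewrite normr0.
have := @wsum_le_wcum x (seq.filter (mem s) t) 1.
rewrite powR1 mulr1 => /(_ _)/le_trans -> //; apply: wcum_le.
apply: leq_trans sN; apply: uniq_leq_size; first exact: filter_uniq.
by move=> i; rewrite mem_filter => /andP[].
Qed.

Lemma flat_add N x : flat N x -> exists L, forall n, (L <= n)%N ->
  flat N.+1 (x + unit_vec n) /\ flat N.+1 (x - unit_vec n).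
Proof.
move=> [s [sN xs x1]]; exists (\sum_(j <- s) j).+1 => n ns.
have {}ns : n \notin s.
  by apply/negP => h; move: ns; rewrite (big_rem n) //= ltnNge leq_addr.
have uE k : unit_vec n k = (k == n)%:R by [].
split; exists (n :: s); split => // k; rewrite ?inE ?negb_or.
- by move=> /andP[/negPf kn /xs]; rewrite fctE uE kn addr0.
- rewrite fctE uE; case: eqP => [->|_]; last by rewrite addr0.
  by rewrite xs // add0r normr1.
- move=> /andP[/negPf kn /xs].
  by rewrite (_ : (x - _) k = x k - unit_vec n k) // uE kn subr0.
- rewrite (_ : (x - _) k = x k - unit_vec n k) // uE; case: eqP => [->|_].
    by rewrite xs // sub0r normrN normr1.
  by rewrite subr0.
Qed.

Lemma flat0 : flat 0 0.
Proof. by exists [::]; split => // k; rewrite normr0. Qed.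

Lemma unit_vec_in_d n : in_d w p (unit_vec n) /\ dnorm w p (unit_vec n) <= 1.
Proof.
have : flat 1 (unit_vec n).
  exists [:: n]; split => // k; rewrite ?inE /unit_vec; first by move=> /negPf->.
  by case: eqP; rewrite ?normr1 ?normr0.
move=> /flat_in_d [d h]; split; first exact: d.
apply: (le_trans h); rewrite /wcum big_nat1.
by case: w_lorentz => -> _ _ _; rewrite powR1.
Qed.

Lemma norm_addsub (a b : R) : `|a| + `|b| <= `|a + b| \/ `|a| + `|b| <= `|a - b|.
Proof.
have h (c : R) : - c <= `|c| by rewrite -normrN ler_norm.
have := ler_norm (a + b); have := ler_norm (a - b).
have := h (a + b); have := h (a - b).
by case: (ler0P a); case: (ler0P b) => *; [left|right|right|left]; lra.
Qed.

(** * Bounded operators and their coordinates *)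

Section Operators.
Variable T : (nat -> R) -> nat -> R.
Hypothesis opT : is_op w p T.

Lemma op_bound : exists2 C, 0 < C &
  forall x, in_d w p x -> dnorm w p (T x) <= C * dnorm w p x.
Proof.
case: opT => _ _ _ _ [C hC]; exists (`|C| + 1); first by rewrite ltr_pwDr.
move=> x dx; apply: (le_trans (hC x dx)); rewrite ler_wpM2r ?dnorm_ge0 //.
by rewrite (le_trans (ler_norm C)) // lerDl.
Qed.

Lemma op0 : T 0 = 0.
Proof.
case: opT => _ _ _ hZ _; have := hZ 0 0 (proj1 in_d0).
have e f : 0 *: f = 0 :> (nat -> R) by apply/funext => i; exact: mul0r.
by rewrite !e.
Qed.

Lemma opB x y : in_d w p x -> in_d w p y -> T (x - y) = T x - T y.
Proof.
case: opT => _ _ hD hZ _ dx dy.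
have e z : - z = -1 *: z :> (nat -> R) by apply/funext => i; exact: esym (mulN1r _).
rewrite (e y) (e (T y)) hD; [|exact: dx|exact: (in_dZ _ dy).1].
by rewrite hZ.
Qed.

(** The rows of the matrix of [T] tend to 0. Otherwise adding [K] basis vectors with suitable signs
    gives a flat vector whose image has [m]-th coordinate at least [e * K] in absolute value, too
    much for its norm. *)
Lemma op_coord_cvg0 m e : 0 < e ->
  exists N, forall n, (N <= n)%N -> `|T (unit_vec n) m| <= e.
Proof.
move=> e0; apply: contrapT => /forallNP h.
have {}h N : exists2 n, (N <= n)%N & e <= `|T (unit_vec n) m|.
  have /existsNP[n /not_implyP[Nn /negP]] := h N.
  by rewrite -ltNge => /ltW; exists n.
have key K : exists2 x, flat K x & e * K%:R <= `|T x m|.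
  elim: K => [|K [x fx hx]]; first by exists 0; [exact: flat0|rewrite mulr0].
  have [L hL] := flat_add fx; have [n Ln hn] := h L.
  have [f1 f2] := hL _ Ln.
  have dx := (flat_in_d fx).1; have dn := (unit_vec_in_d n).1.
  have E1 : T (x + unit_vec n) m = T x m + T (unit_vec n) m.
    by case: opT => _ _ -> // _.
  have E2 : T (x - unit_vec n) m = T x m - T (unit_vec n) m by rewrite opB.
  have : e * K.+1%:R <= `|T (x + unit_vec n) m| \/
      e * K.+1%:R <= `|T (x - unit_vec n) m|.
    rewrite E1 E2 -natr1 mulrDr mulr1.
    move: (T x m) (T (unit_vec n) m) hx hn => a b ha hb.
    by case: (norm_addsub a b); [left|right]; lra.
  by case=> ?; [exists (x + unit_vec n)|exists (x - unit_vec n)].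
have [C C0 hC] := op_bound.
have [|K K0 hK] := @wcum_small (e / (2 * C)); first by rewrite divr_gt0 ?mulr_gt0.
have [x fx hx] := key K; have [dx nx] := flat_in_d fx.
have dTx : in_d w p (T x) by case: opT => + _ _ _ _; apply.
have h1 := le_trans hx (le_trans (norm_le_dnorm m dTx) (hC x dx)).
(* Since [wcum K] is at least 1 and [1 / p] at most 1. The upper bound becomes [e * K / 2]. *)
have h2 : wcum K `^ p^-1 <= wcum K.
  by rewrite ler1_powR ?wcum_ge1 // invf_le1.
have h3 := le_trans h1 (ler_wpM2l (ltW C0) (le_trans nx (le_trans h2 hK))).
have K0' : 0 < K%:R :> R by rewrite ltr0n.
move: h3; rewrite (_ : C * (e / (2 * C) * K%:R) = e * K%:R / 2); last first.
  by rewrite invfM mulrA mulrCA (mulrC 2^-1) !mulrA mulfK ?lt0r_neq0 // mulrAC.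
have := mulr_gt0 e0 K0'; lra.
Qed.

End Operators.

(** * Operators that are null on the basis *)

Lemma wsum_drop a x M s (b : R) : 0 <= b -> (forall i, i \in s -> `|x i| <= b) ->
  wsum a x s <= M%:R * b `^ p + wsum (a + M) x (drop M s).
Proof.
move=> b0 h; rewrite -{1}(cat_take_drop M s) wsum_cat lerD //.
  apply: le_trans (_ : (size (take M s))%:R * b `^ p <= _).
    by apply: wsum_le_size => i /mem_take; exact: h.
  by rewrite ler_wpM2r ?powR_ge0 // ler_nat size_take_min geq_minl.
have [Ms|/ltnW Ms] := leqP M (size s); first by rewrite size_takel.
by rewrite drop_oversize.
Qed.

(** When entries are small, little is lost by giving up [M] positions and all indices below [L]. The
    remaining [t] can then be appended to a list of length [M] with indices below [L]. *)
Lemma wsum_off x M L s (b : R) : 0 <= b -> (forall i, `|x i| <= b) -> uniq s ->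
  exists t, [/\ uniq t, forall i, i \in t -> (L <= i)%N &
    wsum 0 x s <= (M + L)%:R * b `^ p + wsum M x t].
Proof.
move=> b0 h us; exists (seq.filter (leq L) (drop M s)); split.
- by rewrite filter_uniq ?drop_uniq.
- by move=> i; rewrite mem_filter => /andP[].
apply: le_trans (@wsum_drop 0 x M s b b0 (fun i _ => h i)) _.
rewrite add0n natrD mulrDl -addrA lerD2l addrC.
apply: le_trans (@wsum_filter M x _ (leq L) b (fun i _ _ => h i)) _.
rewrite lerD2l ler_wpM2r ?powR_ge0 // ler_nat -size_filter -[leqRHS](size_iota 0).
apply: uniq_leq_size; first by rewrite filter_uniq ?drop_uniq.
by move=> i; rewrite mem_filter mem_iota /= -ltnNge => /andP[].
Qed.

(** Smallness is measured in the sup norm, not in the norm of the space. *)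
Definition null_on_basis (V : (nat -> R) -> nat -> R) :=
  forall e, 0 < e -> exists N, forall n, (N <= n)%N ->
    forall m, `|V (unit_vec n) m| <= e.

Lemma null_on_basis_not_bounded_below V c : is_op w p V -> null_on_basis V ->
  0 < c -> exists n, dnorm w p (V (unit_vec n)) < c.
Proof.
move=> opV nV c0; apply: contrapT => /forallNP h.
have {}h n : c <= dnorm w p (V (unit_vec n)) by rewrite leNgt; apply/negP.
have dV x : in_d w p x -> in_d w p (V x) by case: opV => + _ _ _ _; apply.
(* Strictly below [c ^ p], so that some finite list already carries [d]. *)
pose d := c `^ p / 2.
have cp0 : 0 < c `^ p by rewrite powR_gt0.
have d0 : 0 < d by rewrite divr_gt0.
have big n : exists2 s, uniq s & d <= wsum 0 (V (unit_vec n)) s.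
  apply: contrapT => /forall2NP hs.
  have [||_] := @in_d_dnorm_le (V (unit_vec n)) (d `^ p^-1); first exact: powR_ge0.
    move=> s us; rewrite -powRrM mulVf // powRr1 ?(ltW d0) // leNgt; apply/negP => /ltW.
    by case: (hs s).
  move=> /(le_trans (h n)); apply/negP; rewrite -ltNge.
  rewrite ltNge -powR_leP ?powR_ge0 ?(ltW c0) // -ltNge.
  by rewrite -powRrM mulVf // powRr1 ?(ltW d0) // /d; lra.
have key K : exists x s, [/\ flat K x, uniq s & d / 2 * K%:R <= wsum 0 (V x) s].
  elim: K => [|K [x [s [fx us hs]]]].
    by exists 0, [::]; rewrite mulr0; split => //; exact: flat0.
  have [L1 hL1] := flat_add fx.
  pose L := (\sum_(j <- s) j).+1; pose M := size s.
  (* Chosen so that [(M + L) * b ^ p = d / 2]: discarding positions and indices loses at most half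
     of [d]. *)
  pose b := (d / 2 / (M + L)%:R) `^ p^-1.
  have ML : 0 < (M + L)%:R :> R by rewrite ltr0n addnS.
  have b0 : 0 < b by rewrite powR_gt0 // !divr_gt0.
  have [N hN] := nV b b0.
  pose n := maxn N L1; set u := unit_vec n.
  have [fp fm] := hL1 n (leq_maxr _ _).
  have [t0 ut0 ht0] := big n.
  have [t [ut tL ht]] := @wsum_off (V u) M L t0 b (ltW b0) (hN n (leq_maxl _ _)) ut0.
  have {}ht : d / 2 <= wsum M (V u) t.
    have := le_trans ht0 ht; rewrite {1}/b -powRrM mulVf // powRr1; last first.
      by rewrite !divr_ge0 // ltW.
    rewrite mulrC divfK ?lt0r_neq0 //; lra.
  have ust : uniq (s ++ t).
    rewrite cat_uniq us ut andbT; apply/hasPn => i it; apply/negP => /= is_.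
    by have := tL _ it; rewrite /L (big_rem i) //= ltnNge leq_addr.
  have dx := (flat_in_d fx).1; have du := (unit_vec_in_d n).1.
  have ED : V (x + u) = V x + V u by case: opV => _ _ -> .
  have EB : V (x - u) = V x - V u by rewrite (opB opV).
  (* Averaged over both signs, the sum keeps the part of [V x] on [s] and, with the roles exchanged,
     that of [V u] on [t]. Hence one of the signs achieves both together. *)
  have h1 : wsum 0 (V x) s <= 2^-1 * wsum 0 (V (x + u)) s + 2^-1 * wsum 0 (V (x - u)) s.
    by rewrite ED EB; exact: wsum_midpoint.
  have h2 : wsum M (V u) t <= 2^-1 * wsum M (V (x + u)) t + 2^-1 * wsum M (V (x - u)) t.
    apply: (le_trans (wsum_midpoint M (V u) (V x) t)).
    rewrite ED EB (addrC (V u)); rewrite lerD2l ler_pM2l ?invr_gt0 //.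
    apply: le_wsum => i _; rewrite (_ : (V u - V x) i = V u i - V x i) //.
    by rewrite (_ : (V x - V u) i = V x i - V u i) // distrC.
  have : d / 2 * K.+1%:R <= wsum 0 (V (x + u)) (s ++ t) \/
         d / 2 * K.+1%:R <= wsum 0 (V (x - u)) (s ++ t).
    rewrite !wsum_cat add0n -/M -(natr1 K) mulrDr mulr1.
    move: h1 h2 hs ht.
    move: (wsum 0 (V x) s) (wsum 0 (V (x + u)) s) (wsum 0 (V (x - u)) s).
    move: (wsum M (V u) t) (wsum M (V (x + u)) t) (wsum M (V (x - u)) t).
    move: (d / 2) (d / 2 * _) => B A x1 x2 x3 x4 x5 x6 *.
    by have [?|?] := leP (A + B) (x5 + x2); [left|right; lra].
  by case=> ?; [exists (x + u)|exists (x - u)]; exists (s ++ t).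
have [C C0 hC] := op_bound opV; have Cp0 : 0 < C `^ p by rewrite powR_gt0.
(* The upper bound becomes [d / 4 * K], half of the lower bound from [key]. *)
have [|K K0 hK] := @wcum_small (d / 4 / C `^ p); first by rewrite !divr_gt0.
have [x [s [fx us hs]]] := key K; have [dx nx] := flat_in_d fx.
have h1 := le_trans hs (wsum_le_dnorm (dV x dx) us).
have h2 : dnorm w p (V x) `^ p <= C `^ p * wcum K.
  apply: le_trans (_ : (C * dnorm w p x) `^ p <= _).
    by rewrite powR_leP ?mulr_ge0 ?dnorm_ge0 ?(ltW C0) //; exact: hC.
  rewrite powRM ?dnorm_ge0 ?(ltW C0) // ler_pM2l //.
  apply: le_trans (_ : (wcum K `^ p^-1) `^ p <= _).
    by rewrite powR_leP ?powR_ge0 ?dnorm_ge0.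
  by rewrite -powRrM mulVf // powRr1 ?wcum_ge0.
have := le_trans (le_trans h1 h2) (ler_wpM2l (ltW Cp0) hK).
rewrite (_ : C `^ p * _ = d / 4 * K%:R); last first.
  by rewrite mulrA (mulrC (C `^ p)) divfK // lt0r_neq0.
have K0' : 0 < K%:R :> R by rewrite ltr0n.
by have := mulr_gt0 d0 K0'; lra.
Qed.

(** * Truncations and matrix expansions *)

Definition trunc (K : nat) x : nat -> R := fun k => if (k < K)%N then x k else 0.

Lemma trunc_in_d K x : in_d w p x -> in_d w p (trunc K x).
Proof.
move=> dx; apply: (in_d_le dx _).1 => i.
by rewrite /trunc; case: ifP => // _; rewrite normr0.
Qed.

(** Take [s] whose sum is within [h] of optimal. A list beyond [s] adds at most [h] when appended to
    [s], and starting it at position 0 instead costs at most [size s] small terms. *)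
Lemma trunc_approx x e : in_d w p x -> 0 < e ->
  exists N, forall K, (N <= K)%N -> dnorm w p (x - trunc K x) <= e.
Proof.
move=> dx e0; pose h := e `^ p / 2.
have h0 : 0 < h by rewrite divr_gt0 ?powR_gt0.
have hh : h + h = e `^ p by rewrite /h -splitr.
clearbody h.
(* Otherwise sums could be raised by [h] again and again, past the [p]-th power of the norm. *)
have [s us hs] : exists2 s, uniq s & forall t, uniq t -> wsum 0 x t <= wsum 0 x s + h.
  apply: contrapT => /forall2NP nh.
  have key K : exists2 s, uniq s & h * K%:R <= wsum 0 x s.
    elim: K => [|K [s us hs]]; first by exists [::]; rewrite ?mulr0.
    case: (nh s) => // /existsNP[t /not_implyP[ut /negP]]; rewrite -ltNge => ht.
    by exists t => //; rewrite -(natr1 K) mulrDr mulr1; lra.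
  pose K := Num.bound (dnorm w p x `^ p / h).
  have [s us hs] := key K.
  have := archi_boundP (divr_ge0 (powR_ge0 (dnorm w p x) p) (ltW h0)).
  rewrite -/K ltr_pdivrMr // mulrC; apply/negP; rewrite -leNgt.
  exact: le_trans (wsum_le_dnorm dx us).
pose b := (h / (size s).+1%:R) `^ p^-1.
have b0 : 0 < b by rewrite powR_gt0 // divr_gt0.
have [N hN] := (iffLR (cvg0P x)) dx.1 _ b0.
exists (maxn N (\sum_(j <- s) j).+1) => K; rewrite geq_max => /andP[NK sK].
have yE i : (x - trunc K x) i = if (i < K)%N then 0 else x i.
  rewrite (_ : (x - _) i = x i - trunc K x i) // /trunc.
  by case: ifP; rewrite ?subrr ?subr0.
apply: (in_d_dnorm_le (ltW e0) _).2 => t ut.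
have := @wsum_filter 0 (x - trunc K x) t (leq K) 0.
rewrite powR0 // mulr0 addr0 => /(_ _)/le_trans -> //.
  by move=> i _; rewrite -ltnNge yE => ->; rewrite normr0.
set t' := seq.filter _ _.
have tK i : i \in t' -> (K <= i)%N by rewrite mem_filter => /andP[].
apply: (@le_trans _ _ (wsum 0 x t')).
  by apply: le_wsum => i /tK; rewrite yE ltnNge => ->.
have := @wsum_drop 0 x (size s) t' b (ltW b0).
move=> /(_ _)/le_trans -> //; first by move=> i /tK Ki; apply: hN; exact: leq_trans Ki.
have : (size s)%:R * b `^ p <= h.
  have -> : b `^ p = h / (size s).+1%:R.
    by rewrite /b -powRrM mulVf // powRr1 // divr_ge0 // ltW.
  by rewrite mulrCA ger_pMr // ler_pdivrMr // mul1r ler_nat.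
have : uniq (s ++ drop (size s) t').
  rewrite cat_uniq us drop_uniq ?filter_uniq // andbT.
  apply/hasPn => i /mem_drop /tK Ki; apply/negP => /= is_.
  by have := leq_trans sK Ki; rewrite (big_rem i) //= ltnNge leq_addr.
by move=> /hs; rewrite wsum_cat !add0n => h1 h2; rewrite [leRHS](esym hh); lra.
Qed.

Lemma op_trunc T x K m : is_op w p T -> in_d w p x ->
  T (trunc K x) m = \sum_(0 <= k < K) x k * T (unit_vec k) m.
Proof.
move=> opT dx; elim: K => [|K IH].
  rewrite big_geq // (_ : trunc 0 x = 0) ?(op0 opT) //.
rewrite big_nat_recr //= -IH.
have -> : trunc K.+1 x = trunc K x + x K *: unit_vec K.
  apply/funext => i; rewrite (_ : (_ + _) i = trunc K x i + x K * (i == K)%:R) //.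
  rewrite /trunc ltnS leq_eqVlt; case: eqP => [->|_] /=.
    by rewrite ltnn add0r mulr1.
  by rewrite mulr0 addr0.
have du := (unit_vec_in_d K).1; have dt := trunc_in_d K dx.
case: opT => _ _ hD hZ _.
by rewrite (hD _ _ dt (in_dZ _ du).1) (hZ _ _ du).
Qed.

Lemma op_coord_approx T x m e : is_op w p T -> in_d w p x -> 0 < e ->
  exists N, forall K, (N <= K)%N ->
    `|T x m - \sum_(0 <= k < K) x k * T (unit_vec k) m| <= e.
Proof.
move=> opT dx e0; have [C C0 hC] := op_bound opT.
have [N hN] := trunc_approx dx (divr_gt0 e0 C0).
exists N => K NK; have dt := trunc_in_d K dx; rewrite -op_trunc //.
have dxt := (in_dB dx dt).1.
have -> : T x m - T (trunc K x) m = T (x - trunc K x) m by rewrite (opB opT).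
have dTx : in_d w p (T (x - trunc K x)) by case: opT => + _ _ _ _; apply.
apply: (le_trans (norm_le_dnorm m dTx)); apply: (le_trans (hC _ dxt)).
by rewrite mulrC -ler_pdivlMr // hN.
Qed.

(** * Construction of operators *)

(** Enforces the normalization in [is_op] that operators vanish off the space, so that [f] matters
    on the space only. *)
Definition mk_op (f : (nat -> R) -> nat -> R) x : nat -> R :=
  if `[< in_d w p x >] then f x else 0.

Lemma mk_opE f x : in_d w p x -> mk_op f x = f x.
Proof. by move=> dx; rewrite /mk_op; case: asboolP. Qed.

Lemma mk_op_is_op f (C : R) :
  (forall x, in_d w p x -> in_d w p (f x) /\ dnorm w p (f x) <= C * dnorm w p x) ->
  (forall x y, in_d w p x -> in_d w p y -> f (x + y) = f x + f y) ->
  (forall (a : R) x, in_d w p x -> f (a *: x) = a *: f x) ->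
  is_op w p (mk_op f).
Proof.
move=> hf hD hZ; split.
- move=> x dx; rewrite (mk_opE f dx); exact: (hf x dx).1.
- by move=> x ndx; rewrite /mk_op; case: asboolP.
- move=> x y dx dy; rewrite (mk_opE f (in_dD dx dy).1) (mk_opE f dx) (mk_opE f dy).
  exact: hD.
- move=> a x dx; rewrite (mk_opE f (in_dZ a dx).1) (mk_opE f dx); exact: hZ.
- exists C => x dx; rewrite (mk_opE f dx); exact: (hf x dx).2.
Qed.

Lemma op_comp S T : is_op w p S -> is_op w p T -> is_op w p (S \o T).
Proof.
move=> opS opT; have [C C0 hC] := op_bound opS; have [B B0 hB] := op_bound opT.
case: (opS) => Sd Sn SD SZ _; case: (opT) => Td Tn TD TZ _; split.
- move=> x dx; exact: Sd (Td x dx).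
- move=> x /Tn /= ->; exact: op0.
- move=> x y dx dy; rewrite /= (TD x y dx dy); exact: SD (Td x dx) (Td y dy).
- move=> a x dx; rewrite /= (TZ a x dx); exact: SZ a _ (Td x dx).
- exists (C * B) => x dx; apply: (le_trans (hC _ (Td _ dx))).
  by rewrite -mulrA ler_pM2l //; exact: hB.
Qed.

Definition id_op := mk_op id.

Lemma id_op_is_op : is_op w p id_op.
Proof. by apply: (@mk_op_is_op id 1) => // x dx; split; [exact: dx|rewrite mul1r]. Qed.

Lemma in_d_weighted_comp (a : nat -> R) (C : R) (f : nat -> nat) x :
  injective f -> (forall j, `|a j| <= C) -> in_d w p x ->
  in_d w p (fun j => a j * x (f j)) /\
  dnorm w p (fun j => a j * x (f j)) <= C * dnorm w p x.
Proof.
move=> fi aC dx; have C0 : 0 <= C by exact: le_trans (aC 0%N).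
have [dxf nxf] := in_d_comp fi dx; have [dC nC] := in_dZ C dxf.
have [|dz nz] := @in_d_le (fun j => a j * x (f j)) _ dC.
  move=> i; rewrite (_ : (C *: (x \o f)) i = C * x (f i)) // !normrM.
  by rewrite ler_wpM2r // (ger0_norm C0).
split; first exact: dz.
apply: (le_trans nz); apply: (le_trans nC).
rewrite (ger0_norm C0); exact: ler_wpM2l C0 _ _ nxf.
Qed.

Lemma weighted_comp_op (a : nat -> R) (C : R) (f : nat -> nat) :
  injective f -> (forall j, `|a j| <= C) ->
  is_op w p (mk_op (fun x j => a j * x (f j))).
Proof.
move=> fi aC; apply: (@mk_op_is_op _ C).
- by move=> x; exact: in_d_weighted_comp.
- by move=> x y _ _; apply/funext => j; exact: mulrDr.
- by move=> c x _; apply/funext => j; exact: mulrCA.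
Qed.

(** For injective [f], the operator sending the [k]-th basis vector to the [f k]-th. The test guards
    [xget], whose default is never reached. *)
Definition spread (f : nat -> nat) x : nat -> R :=
  fun i => if `[< exists k, f k = i >] then x (xget 0%N [set k | f k = i]) else 0.

Lemma spread_in_d f x : injective f -> in_d w p x ->
  in_d w p (spread f x) /\ dnorm w p (spread f x) <= dnorm w p x.
Proof.
move=> fi dx; pose g i := xget 0%N [set k | f k = i].
have fg i : (exists k, f k = i) -> f (g i) = i.
  by move=> ex; exact: (@xgetPex _ 0%N [set k | f k = i] ex).
apply: in_d_dnorm_le => [|s us]; first exact: dnorm_ge0.
pose P i := `[< exists k, f k = i >].
have := @wsum_filter 0 (spread f x) s P 0.
rewrite powR0 // mulr0 addr0 => /(_ _)/le_trans -> //.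
  by move=> i _ /negPf Pi; rewrite /spread -/(P i) Pi normr0.
apply: le_trans (wsum_le_dnorm dx (_ : uniq (map g (seq.filter P s)))).
  elim: s 0%N {us} => //= i s IH a; case: ifPn => // Pi /=.
  by rewrite {1}/spread -/(P i) Pi lerD2l.
rewrite map_inj_in_uniq ?filter_uniq // => i j.
rewrite !mem_filter => /andP[/asboolP/fg gi _] /andP[/asboolP/fg gj _] gij.
by rewrite -gi -gj gij.
Qed.

Lemma spread_op f : injective f -> is_op w p (mk_op (spread f)).
Proof.
move=> fi; apply: (@mk_op_is_op _ 1).
- by move=> x dx; rewrite mul1r; exact: spread_in_d.
- move=> x y _ _; apply/funext => i.
  rewrite (_ : (_ + _) i = spread f x i + spread f y i) // /spread.
  by case: ifP => // _; rewrite addr0.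
- move=> c x _; apply/funext => i.
  rewrite (_ : (c *: spread f x) i = c * spread f x i) // /spread.
  by case: ifP => // _; rewrite mulr0.
Qed.

Lemma spread_unit_vec f k : injective f -> spread f (unit_vec k) = unit_vec (f k).
Proof.
move=> fi; apply/funext => i; rewrite /spread /unit_vec; case: asboolP => [ex|nex].
  have /= gi := @xgetPex _ 0%N [set k | f k = i] ex; set g := xget _ _ in gi *.
  by rewrite -gi (inj_eq fi).
by case: eqP => // ik; case: nex; exists k.
Qed.

(** * Geometric estimates *)

Lemma sum_half_le (s : seq nat) : uniq s -> \sum_(j <- s) (2^-1 : R) ^+ j <= 2.
Proof.
move=> us; pose M := (\sum_(j <- s) j).+1.
have sM j : j \in s -> (j < M)%N by move=> js; rewrite ltnS (big_rem j) //= leq_addr.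
clearbody M.
have sE : perm_eq s [seq j <- iota 0 M | j \in s].
  apply: uniq_perm => [//||j]; first by apply: filter_uniq; exact: iota_uniq.
  rewrite mem_filter mem_iota /= add0n.
  by case js : (j \in s); rewrite ?(sM _ js).
rewrite (perm_big _ sE).
rewrite big_filter; apply: (@le_trans _ _ (\sum_(0 <= j < M) (2^-1 : R) ^+ j)).
  rewrite /index_iota subn0 big_mkcond /=; apply: ler_sum => j _.
  by case: ifP => // _; rewrite exprn_ge0.
suff -> : \sum_(0 <= j < M) (2^-1 : R) ^+ j = 2 - 2 * 2^-1 ^+ M.
  by rewrite gerBl mulr_ge0 // exprn_ge0.
elim: M {sM sE} => [|M IH]; first by rewrite big_geq // expr0; lra.
by rewrite big_nat_recr //= IH exprS; lra.
Qed.

(** Turns coordinate bounds into norm bounds: weights are at most 1, the [p]-th power of [2^-j] is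
    at most [2^-j], and [2 * c ^ p] is at most [(2 * c) ^ p]. *)
Lemma geometric_in_d (c : R) x : 0 <= c -> (forall j, `|x j| <= c * 2^-1 ^+ j) ->
  in_d w p x /\ dnorm w p x <= 2 * c.
Proof.
move=> c0 h; apply: in_d_dnorm_le => [|s us]; first by rewrite mulr_ge0.
have h1 a : wsum a x s <= c `^ p * \sum_(j <- s) (2^-1 : R) ^+ j.
  elim: s a {us} => [|i s IH] a; first by rewrite big_nil mulr0.
  rewrite big_cons mulrDr /=; apply: lerD; last exact: IH.
  rewrite -[leRHS]mul1r; apply: ler_pM; rewrite ?w_ge0 ?w_le1 ?powR_ge0 //.
  have i0 : 0 <= (2^-1 : R) ^+ i by rewrite exprn_ge0.
  apply: le_trans (_ : (c * 2^-1 ^+ i) `^ p <= _).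
    by rewrite powR_leP // mulr_ge0.
  rewrite powRM // ler_wpM2l ?powR_ge0 //; apply: ge1r_powR => //.
  by rewrite exprn_gt0 //= exprn_ile1 // invf_le1 // ler1n.
apply: (le_trans (h1 0%N)); rewrite powRM // mulrC ler_wpM2r ?powR_ge0 //.
by apply: le_trans (sum_half_le us) _; apply: le1r_powR => //; rewrite ler1n.
Qed.

(** The intervals of center [u n] and radius [r n] are nested; the supremum of the left endpoints
    lies in all of them. *)
Lemma geometric_cvg (u : nat -> R) (c : R) : 0 <= c ->
  (forall n, `|u n.+1 - u n| <= c * 2^-1 ^+ n) ->
  exists l, forall n, `|l - u n| <= 2 * c * 2^-1 ^+ n.
Proof.
move=> c0 h; pose r n := 2 * c * (2^-1 : R) ^+ n.
have rS n : r n = 2 * r n.+1 by rewrite /r exprS; lra.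
have r0 n : 0 <= r n by rewrite /r !mulr_ge0 // exprn_ge0.
have step n : `|u n.+1 - u n| <= r n.+1.
  by apply: le_trans (h n) _; rewrite /r exprS; lra.
have lo n k : u n - r n <= u (n + k)%N - r (n + k)%N.
  elim: k => [|k IH]; first by rewrite addn0.
  rewrite addnS; have := step (n + k)%N; rewrite ler_norml => /andP[+ _].
  by have := rS (n + k)%N; lra.
have hi n k : u (n + k)%N + r (n + k)%N <= u n + r n.
  elim: k => [|k IH]; first by rewrite addn0.
  rewrite addnS; have := step (n + k)%N; rewrite ler_norml => /andP[_].
  by have := rS (n + k)%N; lra.
have lohi n m : u n - r n <= u m + r m.
  have := lo n m; have := hi m n; rewrite (addnC m n); have := r0 (n + m)%N; lra.
pose A := [set u n - r n | n in [set: nat]].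
have supA : has_sup A.
  by split; [exists (u 0%N - r 0%N); exists 0%N|exists (u 0%N + r 0%N) => _ [n _ <-]].
exists (sup A) => n; rewrite ler_norml; apply/andP; split.
  have : u n - r n <= sup A by apply: ub_le_sup; [exact: supA.2|exists n].
  by rewrite /r; lra.
have : sup A <= u n + r n by apply: ge_sup; [exact: supA.1|move=> _ [m _ <-]].
by rewrite /r; lra.
Qed.

Lemma geometric_eq0 (a A : R) : (forall n, `|a| <= A * 2^-1 ^+ n) -> a = 0.
Proof.
move=> h; apply/eqP; apply/negPn/negP => a0.
have na : 0 < `|a| by rewrite normr_gt0.
have A0 : 0 < A by have := h 0%N; rewrite expr0 mulr1; exact: lt_le_trans.
have : (fun n => A * 2^-1 ^+ n) @ \oo --> (0 : R).
  rewrite -[X in _ --> X](mulr0 A); apply: cvgMl_tmp; apply: cvg_expr.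
  by rewrite ger0_norm // invf_lt1 // ltr1n.
move=> /cvg0P /(_ (`|a| / 2)) [|N hN]; first by rewrite divr_gt0.
have := hN N (leqnn N); rewrite ger0_norm ?mulr_ge0 ?(ltW A0) ?exprn_ge0 //.
by have := h N; lra.
Qed.

(** * Inverting an operator whose matrix is close to the identity *)

Section NearIdentity.
Variable D : (nat -> R) -> nat -> R.
Hypothesis opD : is_op w p D.
Hypothesis D_basis : forall k j,
  `|D (unit_vec k) j - unit_vec k j| <= 2^-1 ^+ (j + k) / 8.

Let dD x : in_d w p x -> in_d w p (D x).
Proof. by case: opD => h _ _ _ _; exact: h. Qed.

(** Expand along the row [j]: entries of [x] are at most its norm, and the sum of [2^-k] is at most
    2, which turns [1 / 8] into [1 / 4]. *)
Lemma near_id_coord x j : in_d w p x ->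
  `|D x j - x j| <= dnorm w p x / 4 * 2^-1 ^+ j.
Proof.
move=> dx; apply/ler_addgt0Pr => e e0.
have [N hN] := op_coord_approx j opD dx e0.
pose K := maxn N j.+1; have {}hN := hN K (leq_maxl _ _).
have jK : (j < K)%N by exact: leq_maxr.
set S := \sum_(0 <= k < K) _ in hN.
have h1 : `|S - x j| <= dnorm w p x / 4 * 2^-1 ^+ j.
  have -> : S - x j = \sum_(0 <= k < K) x k * (D (unit_vec k) j - unit_vec k j).
    under eq_bigr do rewrite mulrBr.
    rewrite sumrB -/S; congr (_ - _).
    rewrite (bigD1_seq j) ?mem_index_iota ?iota_uniq //= /unit_vec eqxx mulr1.
    rewrite big1 ?addr0 // => i; rewrite eq_sym => /negPf ->; exact: mulr0.
  apply: (le_trans (ler_norm_sum _ _ _)).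
  apply: (@le_trans _ _ (\sum_(0 <= k < K)
      (dnorm w p x * (2^-1 ^+ j / 8)) * 2^-1 ^+ k)).
    apply: ler_sum => k _; rewrite normrM -mulrA; apply: ler_pM => //.
      exact: norm_le_dnorm.
    by apply: le_trans (D_basis k j) _; rewrite exprD mulrAC.
  rewrite -mulr_sumr.
  have h2 := sum_half_le (iota_uniq 0 (K - 0)).
  have h3 : 0 <= dnorm w p x * (2^-1 ^+ j / 8).
    by rewrite mulr_ge0 ?dnorm_ge0 // divr_ge0 // exprn_ge0.
  apply: (le_trans (ler_wpM2l h3 h2)).
  by move: (dnorm w p x) (_ ^+ j) => a b; lra.
have := ler_normD (D x j - S) (S - x j); rewrite addrA subrK.
move: (dnorm w p x) h1 => a h1; lra.
Qed.

(** The perturbation has norm at most [1 / 2], so inversion by a Neumann series is possible. *)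
Lemma near_id_dnorm x : in_d w p x ->
  in_d w p (D x - x) /\ dnorm w p (D x - x) <= dnorm w p x / 2.
Proof.
move=> dx; have c0 : 0 <= dnorm w p x / 4 by rewrite divr_ge0 ?dnorm_ge0.
have [d h] := geometric_in_d c0 (fun j => near_id_coord j dx).
by split; [exact: d|apply: le_trans h _; move: (dnorm w p x) => a; lra].
Qed.

Lemma near_id_bounded_below x : in_d w p x -> dnorm w p x <= 2 * dnorm w p (D x).
Proof.
move=> dx; have [d h] := near_id_dnorm dx; have [_] := in_dB (dD dx) d.
rewrite (_ : D x - (D x - x) = x); last by rewrite opprB addrCA subrr addr0.
by move: (dnorm w p (D x - x)) (dnorm w p (D x)) (dnorm w p x) h => a b c; lra.
Qed.

(** Neumann series as a fixed point iteration [y = x - (D y - y)]. Limits are taken coordinate by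
    coordinate; bounds that are geometric in the coordinate as well give convergence in norm. *)
Lemma near_id_surjective x : in_d w p x -> exists2 y, in_d w p y & D y = x.
Proof.
move=> dx; pose f y := x - (D y - y); pose y_ n := iter n f x.
have yS n : y_ n.+1 = x - (D (y_ n) - y_ n) by [].
have dy n : in_d w p (y_ n).
  elim: n => [|n IH]; first exact: dx.
  by rewrite yS; exact: (in_dB dx (near_id_dnorm IH).1).1.
pose c := dnorm w p x / 4.
have c0 : 0 <= c by rewrite divr_ge0 ?dnorm_ge0.
have step n j : `|(y_ n.+1 - y_ n) j| <= c * 2^-1 ^+ n * 2^-1 ^+ j.
  elim: n j => [|n IH] j.
    have -> : (y_ 1%N - y_ 0%N) j = - (D x j - x j).
      rewrite yS (_ : (_ - _) j = x j - (D x j - x j) - x j) //; lra.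
    by rewrite normrN expr0 mulr1; exact: near_id_coord.
  have d1 := (in_dB (dy n.+1) (dy n)).1.
  have -> : (y_ n.+2 - y_ n.+1) j =
      - (D (y_ n.+1 - y_ n) j - (y_ n.+1 - y_ n) j).
    rewrite (opB opD (dy _) (dy _)) (yS n.+1) [in LHS](_ : (_ - _) j =
      x j - (D (y_ n.+1) j - y_ n.+1 j) - y_ n.+1 j) //.
    have -> : y_ n.+1 j = x j - (D (y_ n) j - y_ n j) by [].
    rewrite (_ : (D (y_ n.+1) - D (y_ n)) j = D (y_ n.+1) j - D (y_ n) j) //.
    rewrite (_ : (y_ n.+1 - y_ n) j = x j - (D (y_ n) j - y_ n j) - y_ n j) //.
    lra.
  rewrite normrN; apply: (le_trans (near_id_coord j d1)).
  have cn0 : 0 <= c * 2^-1 ^+ n by rewrite mulr_ge0 // exprn_ge0.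
  have [_ h] := geometric_in_d cn0 IH.
  rewrite ler_wpM2r ?exprn_ge0 // exprS.
  by move: (dnorm w p _) (c) (_ ^+ n) h => a b b' h; lra.
clearbody c.
have lim j : exists l, forall n, `|l - y_ n j| <= 2 * c * 2^-1 ^+ n * 2^-1 ^+ j.
  have cj0 : 0 <= c * 2^-1 ^+ j by rewrite mulr_ge0 // exprn_ge0.
  have [n|l hl] := @geometric_cvg (fun n => y_ n j) _ cj0.
    by rewrite mulrAC; exact: step.
  by exists l => n; apply: le_trans (hl n) _; rewrite mulrA mulrAC.
have [y hy] := choice lim.
have near n : in_d w p (y - y_ n) /\ dnorm w p (y - y_ n) <= 2 * (2 * c * 2^-1 ^+ n).
  apply: geometric_in_d.
    by apply: mulr_ge0; [exact: mulr_ge0|exact: exprn_ge0].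
  move=> j; exact: hy.
have dyy : in_d w p y.
  by have := (in_dD (near 0%N).1 (dy 0%N)).1; rewrite subrK.
exists y => //; apply/funext => j; apply/eqP; rewrite -subr_eq0; apply/eqP.
have [C C0 hC] := op_bound opD.
apply: (@geometric_eq0 _ (C * (2 * (2 * c)) + c)) => n.
(* By the recursion, [x - D (y_ n)] equals [y_ n.+1 - y_ n]; both terms on the right decay
   geometrically. *)
have -> : D y j - x j = D (y - y_ n) j - (y_ n.+1 - y_ n) j.
  rewrite (opB opD dyy (dy n)) yS (_ : (D y - D (y_ n)) j = D y j - D (y_ n) j) //.
  rewrite [in RHS](_ : (_ - _ - _) j = x j - (D (y_ n) j - y_ n j) - y_ n j) //.
  lra.
have [d1 h1] := near n.
have h2 := le_trans (norm_le_dnorm j (dD d1)) (hC _ d1).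
have h3 := le_trans h2 (ler_wpM2l (ltW C0) h1).
have h4 : `|(y_ n.+1 - y_ n) j| <= c * 2^-1 ^+ n.
  apply: le_trans (step n j) _; apply: ler_piMr; first by rewrite mulr_ge0 ?exprn_ge0.
  by rewrite exprn_ile1 // invf_le1 // ler1n.
apply: le_trans (ler_normB _ _) _; rewrite mulrDl; apply: lerD h4.
by apply: le_trans h3 _; rewrite !mulrA.
Qed.

(** Preimages are chosen pointwise; boundedness below makes them unique, hence linear in [x], with
    bound 2. *)
Lemma near_id_right_inverse : exists2 F, is_op w p F &
  forall x, in_d w p x -> D (F x) = x.
Proof.
have ex x : exists y, in_d w p x -> in_d w p y /\ D y = x.
  have [dx|ndx] := pselect (in_d w p x); last by exists 0 => /ndx.
  by have [y dy Dy] := near_id_surjective dx; exists y.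
have [F hF] := choice ex.
have inj x y : in_d w p x -> in_d w p y -> D x = D y -> x = y.
  move=> dx dy Dxy; have dxy := (in_dB dx dy).1.
  have := near_id_bounded_below dxy.
  rewrite (opB opD dx dy) Dxy subrr in_d0.2 mulr0 => h.
  apply/funext => i; apply/eqP; rewrite -subr_eq0 -normr_le0.
  exact: le_trans (norm_le_dnorm i dxy) h.
exists (mk_op F); last by move=> x dx; rewrite (mk_opE F dx); exact: (hF x dx).2.
case: (opD) => _ _ DD DZ _.
apply: (@mk_op_is_op F 2).
- move=> x dx; have [dF DF] := hF x dx; split; first exact: dF.
  by have := near_id_bounded_below dF; rewrite DF.
- move=> x y dx dy; have [dFx DFx] := hF x dx; have [dFy DFy] := hF y dy.
  have [dFxy DFxy] := hF _ (in_dD dx dy).1.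
  apply: inj; [exact: dFxy|exact: (in_dD dFx dFy).1|].
  by rewrite DFxy (DD _ _ dFx dFy) DFx DFy.
- move=> a x dx; have [dFx DFx] := hF x dx; have [dFa DFa] := hF _ (in_dZ a dx).1.
  apply: inj; [exact: dFa|exact: (in_dZ a dFx).1|].
  by rewrite DFa (DZ a _ dFx) DFx.
Qed.

End NearIdentity.

(** * Factoring the identity *)

Lemma eventually_forall_lt (P : nat -> nat -> Prop) :
  (forall i, exists N, forall n, (N <= n)%N -> P i n) ->
  forall K, exists N, forall n, (N <= n)%N -> forall i, (i < K)%N -> P i n.
Proof.
move=> h; elim=> [|K [N hN]]; first by exists 0%N.
have [M hM] := h K; exists (maxn N M) => n; rewrite geq_max => /andP[Nn Mn] i.
by rewrite ltnS leq_eqVlt => /orP[/eqP->|]; [exact: hM|exact: hN].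
Qed.

(** Columns of the matrix tend to 0 because images lie in the space, rows by [op_coord_cvg0]. So a
    large entry exists far out, nearly decoupled from the first [N] rows and columns. *)
Lemma not_null_step V : is_op w p V -> ~ null_on_basis V ->
  exists2 d, 0 < d & forall e N, 0 < e -> exists n m,
    [/\ (N <= n)%N, (N <= m)%N, d < `|V (unit_vec n) m|,
      forall j, (j < N)%N -> `|V (unit_vec n) j| <= e
    & forall k, (k < N)%N -> `|V (unit_vec k) m| <= e].
Proof.
move=> opV /existsNP[d /not_implyP[d0 /forallNP hd]].
exists d => // e N e0.
have [k|L hL] := @eventually_forall_lt (fun k m => `|V (unit_vec k) m| <= e) _ N.
  have dV : in_d w p (V (unit_vec k)).
    by case: opV => h _ _ _ _; exact: h _ (unit_vec_in_d k).1.
  exact: (iffLR (cvg0P _)) dV.1 _ e0.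
(* The bound by [d] on the first [maxn L N] rows forces the large entry into a later row. *)
have e'0 : 0 < Num.min e d by rewrite lt_min e0 d0.
have [M hM] := eventually_forall_lt (fun j => op_coord_cvg0 opV j e'0) (maxn L N).
have /existsNP[n /not_implyP[]] := hd (maxn M N).
rewrite geq_max => /andP[Mn Nn] /existsNP[m /negP]; rewrite -ltNge => dm.
have {}hM j : (j < maxn L N)%N -> `|V (unit_vec n) j| <= Num.min e d by exact: hM.
have : (maxn L N <= m)%N.
  rewrite leqNgt; apply/negP => /hM; rewrite le_min => /andP[_].
  by apply/negP; rewrite -ltNge.
rewrite geq_max => /andP[Lm Nm]; exists n, m; split=> // [j jN|k kN].
  by have := hM j; rewrite leq_max jN orbT => /(_ isT); rewrite le_min => /andP[].
exact: hL.
Qed.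

(** With [S] spreading basis vectors to the columns [n k], and [B] reading the rows [m j] divided by
    the diagonal entries, [B \o V \o S] is close to the identity. Its right inverse is absorbed into
    [A]. *)
Lemma identity_factors_through V : is_op w p V -> ~ null_on_basis V ->
  exists A B, [/\ is_op w p A, is_op w p B &
    forall x, in_d w p x -> B (V (A x)) = x].
Proof.
move=> opV nV; have [d d0 step] := not_null_step opV nV.
(* For [l = maxn j k], [4^-l] is at most [2^-(j + k)]. The factor [d] cancels against the inverse
   diagonal entries, and [1 / 8] is the closeness required for inversion. *)
pose eta l : R := d * (4^-1 ^+ l / 8).
have eta0 l : 0 < eta l by rewrite mulr_gt0 // divr_gt0 // exprn_gt0.
have /choice[g hg] : forall q : nat * nat, exists r : nat * nat,
    [/\ (q.2 <= r.1)%N, (q.2 <= r.2)%N, d < `|V (unit_vec r.1) r.2|,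
      forall j, (j < q.2)%N -> `|V (unit_vec r.1) j| <= eta q.1
    & forall k, (k < q.2)%N -> `|V (unit_vec k) r.2| <= eta q.1].
  by move=> [l N]; have [n [m h]] := step _ N (eta0 l); exists (n, m).
(* Strictly above both chosen indices, so that each stage lies beyond all earlier ones. *)
pose bound (r : nat * nat) := (maxn r.1 r.2).+1.
pose st := fix st l := if l is l'.+1 then g (l, bound (st l')) else g (0%N, 0%N).
pose N l := if l is l'.+1 then bound (st l') else 0%N.
have stE l : st l = g (l, N l) by case: l.
pose n l := (st l).1; pose m l := (st l).2.
have hst l : [/\ (N l <= n l)%N, (N l <= m l)%N, d < `|V (unit_vec (n l)) (m l)|,
      forall j, (j < N l)%N -> `|V (unit_vec (n l)) j| <= eta l
    & forall k, (k < N l)%N -> `|V (unit_vec k) (m l)| <= eta l].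
  by rewrite /n /m stE; exact: hg (l, N l).
have ltN j l : (j < l)%N -> (n j < N l)%N /\ (m j < N l)%N.
  elim: l => // l IH; rewrite ltnS leq_eqVlt => /orP[/eqP->|/IH [h1 h2]].
    by rewrite /= /bound !ltnS leq_maxl leq_maxr.
  have [h3 _ _ _ _] := hst l; have h4 : (n l < N l.+1)%N by rewrite ltnS leq_maxl.
  have h5 := leq_trans h3 (ltnW h4).
  by split; [exact: leq_trans h1 h5|exact: leq_trans h2 h5].
have inj (f : nat -> nat) : (forall j l, (j < l)%N -> (f j < f l)%N) -> injective f.
  move=> hf j l fjl; have [jl|lj|//] := ltngtP j l.
    by have := hf _ _ jl; rewrite fjl ltnn.
  by have := hf _ _ lj; rewrite fjl ltnn.
have n_inj : injective n.
  by apply: inj => j l /ltN[h _]; have [h1 _ _ _ _] := hst l; exact: leq_trans h1.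
have m_inj : injective m.
  by apply: inj => j l /ltN[_ h]; have [_ h1 _ _ _] := hst l; exact: leq_trans h1.
have offdiag j k : j != k -> `|V (unit_vec (n k)) (m j)| <= d * (2^-1 ^+ (j + k) / 8).
  move=> jk; apply: (@le_trans _ _ (eta (maxn j k))).
    move: jk; rewrite neq_ltn => /orP[jk|kj].
      rewrite (maxn_idPr (ltnW jk)); have [_ _ _ h _] := hst k.
      exact: h (ltN _ _ jk).2.
    rewrite (maxn_idPl (ltnW kj)); have [_ _ _ _ h] := hst j.
    exact: h (ltN _ _ kj).1.
  rewrite /eta ler_pM2l // ler_pM2r ?invr_gt0 //.
  have -> : (4^-1 : R) = 2^-1 ^+ 2 by rewrite expr2; lra.
  rewrite -exprM; apply: ler_wiXn2l; rewrite ?invr_ge0 ?invf_le1 ?ler1n //.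
  by rewrite mul2n -addnn leq_add ?leq_maxl ?leq_maxr.
pose a j := (V (unit_vec (n j)) (m j))^-1.
have a_le j : `|a j| <= d^-1.
  have [_ _ h _ _] := hst j.
  rewrite /a normfV lef_pV2 ?posrE //; last exact: lt_trans h.
  exact: ltW.
pose B := mk_op (fun x j => a j * x (m j)).
have opB' : is_op w p B by exact: weighted_comp_op m_inj a_le.
pose S := mk_op (spread n).
have opS : is_op w p S by exact: spread_op.
have opD : is_op w p (B \o V \o S) by apply: op_comp; [exact: op_comp|].
have [k j|F opF hF] := @near_id_right_inverse _ opD; last first.
  exists (S \o F), B; split; [exact: op_comp|exact: opB'|exact: hF].
have dk := (unit_vec_in_d k).1; have dnk := (unit_vec_in_d (n k)).1.
have dV : in_d w p (V (unit_vec (n k))) by case: opV => h _ _ _ _; exact: h.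
have -> : (B \o V \o S) (unit_vec k) = fun j => a j * V (unit_vec (n k)) (m j).
  by rewrite /= /S (mk_opE _ dk) spread_unit_vec // /B (mk_opE _ dV).
have b0 : 0 <= (2^-1 : R) ^+ (j + k) / 8 by rewrite divr_ge0 ?exprn_ge0.
rewrite /unit_vec; case: (eqVneq j k) => [->|jk].
  have [_ _ h _ _] := hst k; rewrite /a mulVf ?subrr ?normr0; last first.
    by rewrite -normr_gt0; exact: lt_trans h.
  by rewrite divr_ge0 ?exprn_ge0.
rewrite subr0 normrM; apply: le_trans (ler_pM _ _ (a_le j) (offdiag j k jk)) _ => //.
by rewrite mulKf ?lt0r_neq0.
Qed.

(** * Strict singularity read on basis vectors *)

(** Otherwise the identity is [B \o T \o U \o A]. The range of [V = U \o A] is then a copy of the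
    space on which [T] is bounded below. *)
Lemma SS_null T U : dwp_SS w p T -> is_op w p U -> null_on_basis (T \o U).
Proof.
move=> [opT hT] opU; apply: contrapT => nTU.
have [A [B [opA opB' BTUA]]] := identity_factors_through (op_comp opT opU) nTU.
have opV := op_comp opU opA; pose V := U \o A.
have dV x : in_d w p x -> in_d w p (V x) by case: opV => h _ _ _ _; exact: h.
have dT x : in_d w p x -> in_d w p (T x) by case: opT => h _ _ _ _; exact: h.
have [C C0 hC] := op_bound opB'; have [CT CT0 hCT] := op_bound opT.
have [CV CV0 hCV] := op_bound opV.
have V0 : V 0 = 0 by exact: op0 opV.
have bT x : in_d w p x -> C^-1 * dnorm w p x <= dnorm w p (T (V x)).
  move=> dx; rewrite ler_pdivrMl //.
  by have := hC _ (dT _ (dV _ dx)); rewrite BTUA.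
case: (opV) => _ _ VD VZ _.
apply: (hT (V @` in_d w p)).
- split.
  + by move=> _ [x dx <-]; exact: dV.
  + by exists 0; [exact: in_d0.1|].
  + move=> _ _ [x dx <-] [y dy <-]; exists (x + y); first exact: (in_dD dx dy).1.
    exact: VD.
  + move=> c _ [x dx <-]; exists (c *: x); first exact: (in_dZ c dx).1.
    exact: VZ.
  + move=> z x hz dx /cvg0P zx.
    (* [G] is a bounded projection onto the range of [V]; limits of its fixed points are fixed, so
       the range is closed. *)
    have opG := op_comp opV (op_comp opB' opT); set G := _ \o _ in opG.
    have [CG CG0 hCG] := op_bound opG.
    have dG y : in_d w p y -> in_d w p (G y) by case: opG => h _ _ _ _; exact: h.
    have Gz k : G (z k) = z k.
      have [y dy <-] := hz k; rewrite /G /=; congr (U (A _)); exact: BTUA.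
    exists (B (T x)).
      by case: opB' => h _ _ _ _; exact: h _ (dT _ dx).
    rewrite -/(G x); apply/funext => i; apply/eqP; rewrite -subr_eq0 -normr_le0.
    apply/ler_addgt0Pr => e e0; rewrite add0r.
    have [|k hk] := zx (e / (CG + 1)); first by rewrite divr_gt0 ?addr_gt0.
    have {hk} := hk k (leqnn k); rewrite ger0_norm ?dnorm_ge0 // => hk.
    have dz : in_d w p (z k) by have [y dy <-] := hz k; exact: dV.
    have dzx := (in_dB dz dx).1.
    have h1 := norm_le_dnorm i dzx.
    have h2 := le_trans (norm_le_dnorm i (dG _ dzx)) (hCG _ dzx).
    have -> : G x i - x i = (z k - x) i - G (z k - x) i.
      rewrite (opB opG dz dx) Gz (_ : (z k - x) i = z k i - x i) //.
      by rewrite (_ : (z k - G x) i = z k i - G x i) //; lra.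
    apply: le_trans (ler_normB _ _) _; apply: le_trans (lerD h1 h2) _.
    rewrite -[X in X + _]mul1r -mulrDl addrC -ler_pdivlMl ?addr_gt0 // mulrC.
    exact: hk.
- exists V; split; first exact: opV.
  split=> //; exists ((C * CT)^-1); split; first by rewrite invr_gt0 mulr_gt0.
  move=> x dx; rewrite ler_pdivrMl ?mulr_gt0 // -mulrA.
  have := bT x dx; rewrite ler_pdivrMl // => /le_trans; apply.
  by rewrite ler_pM2l //; exact: hCT _ (dV _ dx).
- exists (C^-1 * CV^-1); split; first by rewrite mulr_gt0 ?invr_gt0.
  move=> _ [x dx <-]; apply: le_trans (bT x dx); rewrite -mulrA ler_pM2l ?invr_gt0 //.
  by rewrite ler_pdivrMl //; exact: hCV.
Qed.

(** If [T] were bounded below on the range of an embedding [U], the vectors [T (U e_n)] would have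
    norms at least [b * c], although [T \o U] is null on the basis. *)
Lemma null_SS T : is_op w p T ->
  (forall U, is_op w p U -> null_on_basis (T \o U)) -> dwp_SS w p T.
Proof.
move=> opT h; split=> // Z _ [U [opU [UZ [c [c0 hU]]]]] [b [b0 hT]].
have opTU := op_comp opT opU.
have [n] := null_on_basis_not_bounded_below opTU (h U opU) (mulr_gt0 b0 c0).
apply/negP; rewrite -leNgt; have dn := (unit_vec_in_d n).1.
apply: le_trans (hT (U (unit_vec n)) _); last by rewrite -UZ; exists (unit_vec n).
rewrite ler_pM2l //; apply: le_trans (hU _ dn); rewrite ler_pMr //.
by have := norm_le_dnorm n dn; rewrite /unit_vec eqxx normr1.
Qed.

(** * The greatest proper ideal *)

Lemma zero_op : is_op w p (fun _ => 0).
Proof.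
have [d0 n0] := in_d0; split=> //; first by move=> *; rewrite addr0.
  by move=> a x _; apply/funext => i; exact: esym (mulr0 a).
by exists 0 => x _; rewrite n0 mul0r.
Qed.

Lemma add_op S T : is_op w p S -> is_op w p T -> is_op w p (S \+ T).
Proof.
move=> opS opT; have [C C0 hC] := op_bound opS; have [B B0 hB] := op_bound opT.
case: opS opT => Sd Sn SD SZ _ [Td Tn TD TZ _]; split.
- move=> x dx; exact: (in_dD (Sd x dx) (Td x dx)).1.
- by move=> x ndx; rewrite /= (Sn x ndx) (Tn x ndx) addr0.
- by move=> x y dx dy; rewrite /= (SD x y dx dy) (TD x y dx dy) addrACA.
- move=> a x dx; rewrite /= (SZ a x dx) (TZ a x dx); apply/funext => i.
  exact: esym (mulrDr _ _ _).
- exists (C + B) => x dx; apply: (le_trans (in_dD (Sd x dx) (Td x dx)).2).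
  by rewrite mulrDl; apply: lerD; [exact: hC|exact: hB].
Qed.

Lemma scale_op (a : R) T : is_op w p T -> is_op w p (fun x => a *: T x).
Proof.
move=> opT; have [C C0 hC] := op_bound opT; case: opT => Td Tn TD TZ _; split.
- move=> x dx; exact: (in_dZ a (Td x dx)).1.
- by move=> x /Tn ->; apply/funext => i; exact: mulr0.
- move=> x y dx dy; rewrite (TD x y dx dy); apply/funext => i; exact: mulrDr.
- move=> b x dx; rewrite (TZ b x dx); apply/funext => i; exact: mulrCA.
- exists (`|a| * C) => x dx; apply: (le_trans (in_dZ a (Td x dx)).2).
  by rewrite -mulrA; apply: ler_wpM2l => //; exact: hC.
Qed.

(** Straight from the definition: a lower bound for [A \o T] on [Z], divided by a bound of [A], is
    one for [T]. *)
Lemma SS_comp_left A T : is_op w p A -> dwp_SS w p T -> dwp_SS w p (A \o T).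
Proof.
move=> opA [opT hT]; split; first exact: op_comp.
move=> Z cZ iZ [c [c0 hc]]; apply: (hT Z cZ iZ).
have [C C0 hC] := op_bound opA; exists (c / C); split; first exact: divr_gt0.
have [Zd _ _ _ _] := cZ => z Zz; rewrite mulrAC ler_pdivrMr //.
have dTz : in_d w p (T z) by case: opT => h _ _ _ _; exact: h (Zd z Zz).
rewrite [leRHS]mulrC; exact: le_trans (hc z Zz) (hC _ dTz).
Qed.

Lemma SS_ideal : dwp_ideal w p (dwp_SS w p).
Proof.
split.
- by move=> T [].
- apply: null_SS; first exact: zero_op.
  by move=> U opU e e0; exists 0%N => n _ m; rewrite /= normr0 ltW.
- move=> S T hS hT; apply: null_SS; first exact: add_op hS.1 hT.1.
  move=> U opU e e0; have e20 : 0 < e / 2 by rewrite divr_gt0.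
  have [N hN] := SS_null hS opU e20; have [M hM] := SS_null hT opU e20.
  exists (maxn N M) => n; rewrite geq_max => /andP[Nn Mn] m.
  apply: le_trans (ler_normD _ _) _.
  by rewrite [leRHS]splitr; apply: lerD; [exact: hN|exact: hM].
- move=> a T hT; apply: null_SS; first exact: scale_op hT.1.
  move=> U opU e e0; have a0 : 0 < `|a| + 1 by rewrite ltr_wpDl.
  have [N hN] := SS_null hT opU (divr_gt0 e0 a0).
  exists N => n Nn m; rewrite /= [leLHS](normrM a).
  have := hN n Nn m; rewrite ler_pdivlMr // mulrC; apply: le_trans.
  by rewrite ler_wpM2r // lerDl.
- move=> A T opA hT; split; first exact: SS_comp_left.
  apply: null_SS; first exact: op_comp hT.1 opA.
  by move=> U opU; exact: SS_null hT (op_comp opA opU).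
Qed.

Lemma id_op_notin_SS : ~ dwp_SS w p id_op.
Proof.
move=> /SS_null /(_ id_op_is_op) /(_ 2^-1) [|N hN]; first by rewrite invr_gt0.
have := hN N (leqnn N) N; rewrite /= /id_op.
have dN := (unit_vec_in_d N).1; rewrite !(mk_opE _ dN) /unit_vec eqxx normr1.
by move=> ?; lra.
Qed.

Lemma SS_proper_ideal : dwp_proper_ideal w p (dwp_SS w p).
Proof.
split; first exact: SS_ideal.
by move=> SSL; apply: id_op_notin_SS; rewrite SSL; exact: id_op_is_op.
Qed.

Lemma ideal_with_id J : dwp_ideal w p J -> J id_op -> J = Lop w p.
Proof.
move=> [JL _ _ _ Jcomp] J1; apply/seteqP; split=> // S opS.
rewrite (_ : S = S \o id_op); first exact: (Jcomp _ _ opS J1).1.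
(* Off the space [id_op] gives 0, and both sides vanish. *)
apply/funext => x /=; rewrite /id_op /mk_op; case: asboolP => // ndx.
by rewrite (op0 opS); case: opS => _ h _ _ _; exact: h.
Qed.

Lemma proper_ideal_sub_SS J : dwp_proper_ideal w p J -> J `<=` dwp_SS w p.
Proof.
move=> [iJ nJ] T JT; have [JL _ _ _ Jcomp] := iJ; have opT := JL T JT.
apply: null_SS => // U opU; apply: contrapT => nTU.
have [A [B [opA opB' BTUA]]] := identity_factors_through (op_comp opT opU) nTU.
apply: nJ; apply: ideal_with_id => //.
have opBTUA := op_comp opB' (op_comp opT (op_comp opU opA)).
rewrite (_ : id_op = B \o (T \o (U \o A))).
  exact: (Jcomp B _ opB' (Jcomp _ T (op_comp opU opA) JT).2).1.
apply/funext => x; rewrite /id_op /mk_op; case: asboolP => [dx|ndx].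
  exact: esym (BTUA x dx).
by case: opBTUA => _ h _ _ _; rewrite h.
Qed.

(** On the bounded vectors [U e_n], [T] differs little from a strictly singular [S], uniformly in
    [n] and in the coordinate. *)
Lemma SS_norm_closed : dwp_norm_closed w p (dwp_SS w p).
Proof.
move=> T opT hT; apply: null_SS => // U opU e e0.
have [C C0 hC] := op_bound opU.
have [|S [hS TS]] := hT (e / 2 / C); first by rewrite !divr_gt0.
have [|N hN] := SS_null hS opU (_ : 0 < e / 2); first by rewrite divr_gt0.
exists N => n Nn m; have [dn n1] := unit_vec_in_d n.
have du : in_d w p (U (unit_vec n)) by case: opU => h _ _ _ _; exact: h.
have nu : dnorm w p (U (unit_vec n)) <= C.
  by apply: le_trans (hC _ dn) _; rewrite ger_pMr.
rewrite -[leLHS]/`|T (U (unit_vec n)) m|.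
move: (U _) (hN n Nn m : `|S (U (unit_vec n)) m| <= _) du nu => u Su du nu /=.
(* [u] has norm at most [C]; it is rescaled into the unit ball, over which [opnorm] is a
   supremum. *)
have [dv nv] := in_dZ C^-1 du; set v := _ *: u in dv nv.
have v1 : dnorm w p v <= 1.
  apply: (le_trans nv); rewrite ger0_norm ?invr_ge0 ?(ltW C0) //.
  by rewrite ler_pdivrMl // mulr1.
have uv : u = C *: v.
  by apply/funext => i; exact: esym (mulVKf (lt0r_neq0 C0) _).
have opS := hS.1.
have TSv : dnorm w p (T v - S v) <= e / 2 / C.
  rewrite -lee_fin; apply: le_trans (ltW TS).
  by apply: ereal_sup_ubound; exists v.
have dTv : in_d w p (T v) by case: opT => h _ _ _ _; exact: h.
have dSv : in_d w p (S v) by case: opS => h _ _ _ _; exact: h.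
have h1 := le_trans (norm_le_dnorm m (in_dB dTv dSv).1) TSv.
have Tu : T u m = C * T v m by rewrite uv; case: opT => _ _ _ h _; rewrite (h _ _ dv).
have SuE : S u m = C * S v m by rewrite uv; case: opS => _ _ _ h _; rewrite (h _ _ dv).
have -> : T u m = C * (T v - S v) m + S u m.
  by rewrite Tu SuE -mulrDr (_ : (T v - S v) m = T v m - S v m) // subrK.
apply: le_trans (ler_normD _ _) _; rewrite [leRHS]splitr; apply: lerD Su.
by rewrite normrM (gtr0_norm C0) mulrC -ler_pdivlMr.
Qed.

End LorentzIdeals.

Theorem theorem5p3 (R : realType) (w : nat -> R) (p : R) :
  1 <= p -> lorentz_weight w ->
  [/\ dwp_proper_ideal w p (dwp_SS w p),
      (forall J, dwp_proper_ideal w p J -> J `<=` dwp_SS w p)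
    & dwp_norm_closed w p (dwp_SS w p)].
Proof.
move=> p_ge1 w_lorentz; split.
- exact: SS_proper_ideal.
- by move=> J; exact: proper_ideal_sub_SS.
- exact: SS_norm_closed.
Qed.
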